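(* Let $n\ge 5$, let $\Omega\subset\mathbb{R}^n$ be an open domain, and let $V\colon(0,\infty)\to[0,\infty)$ and $H\colon(0,\infty)\to\mathbb{R}$ be smooth functions such that $$-H'(t)+H(t)\cdot\frac{n-1}{t}-H(t)^2\ge V(t),\qquad \forall t>0.$$ (i) If $E_1(t)=H'(t)+H(t)\cdot\frac{n-3}{t}\ge 0$ for all $t>0$, then for every $u\in C_0^\infty(\Omega)$ one has $$\int_\Omega |\Delta u|^2\,\mathrm{d}x\ge\int_\Omega V(|x|)\,|\nabla^{\mathrm{rad}}u|^2\,\mathrm{d}x.$$ (ii) If $E_2(t)=2H'(t)+H(t)\left(H(t)-\frac{2}{t}\right)\ge 0$ for all $t>0$, then for every $u\in C_0^\infty(\Omega)$ one has $$\int_\Omega |\Delta u|^2\,\mathrm{d}x\ge\int_\Omega V(|x|)\,|\nabla u|^2\,\mathrm{d}x.$$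
   Context: $C_0^\infty(\Omega)$ is the space of smooth real-valued functions with compact support in $\Omega$. $\nabla$ and $\Delta$ are the Euclidean gradient and Laplacian. The radial derivative is $\nabla^{\mathrm{rad}}u(x)=\langle\nabla u(x),\nabla|x|\rangle=\langle\nabla u(x),x/|x|\rangle$ for $x\ne 0$ (distance taken from the origin). *)

(* Defs.v *)
From HB Require Import structures.
From mathcomp Require Import all_boot all_order all_algebra.
From mathcomp Require Import all_classical all_reals all_analysis.

Set Implicit Arguments.
Unset Strict Implicit.
Unset Printing Implicit Defensive.

Import Order.TTheory GRing.Theory Num.Theory.
Import numFieldNormedType.Exports.

Local Open Scope classical_set_scope.
Local Open Scope ring_scope.

(* The product sigma-algebra on R^n: the one generated by the coordinate maps,
   with R carrying its Borel sigma-algebra. *)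

Definition measure_rV_display : measure_display -> measure_display.
Proof. exact. Qed.

Section measurable_rV.
Variables (R : realType) (n : nat).

Let coord_rV (i : 'I_n) (x : 'rV[R]_n) : measurableTypeR R := x ord0 i.

Let rV_set0 : g_sigma_preimage coord_rV set0.
Proof. exact: sigma_algebra0. Qed.

Let rV_setC A : g_sigma_preimage coord_rV A -> g_sigma_preimage coord_rV (~` A).
Proof. exact: sigma_algebraC. Qed.

Let rV_bigcup (F : (set 'rV[R]_n)^nat) :
  (forall i, g_sigma_preimage coord_rV (F i)) ->
  g_sigma_preimage coord_rV (\bigcup_i (F i)).
Proof. exact: sigma_algebra_bigcup. Qed.

HB.instance Definition _ :=
  @isMeasurable.Build (measure_rV_display default_measure_display) 'rV[R]_n
    (g_sigma_preimage coord_rV) rV_set0 rV_setC rV_bigcup.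

Lemma measurable_coord_rV (i : 'I_n) :
  measurable_fun [set: 'rV[R]_n]
    (fun x : 'rV[R]_n => x ord0 i : measurableTypeR R).
Proof.
move=> _ Y mY; rewrite setTI; apply: sub_sigma_algebra => /=.
rewrite -bigcup_seq/=; exists i => /=; first by rewrite mem_index_enum.
by exists Y => //; rewrite setTI.
Qed.

Lemma measurable_fun_rVP d (T : measurableType d) (f : T -> 'rV[R]_n) :
  (forall i, measurable_fun [set: T]
     (fun t => f t ord0 i : measurableTypeR R)) ->
  measurable_fun [set: T] f.
Proof.
move=> mf _ A mA; rewrite setTI.
suff: preimage_set_system [set: T] f (g_sigma_preimage coord_rV) `<=` measurable.
  by apply; exists A => //; rewrite setTI.
rewrite -g_sigma_preimage_comp; apply: smallest_sub.
  exact: sigma_algebra_measurable.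
rewrite -bigcup_seq; apply: bigcup_sub => i _.
by move=> B [C mC <-]; exact: mf.
Qed.

Lemma measurable_box (A : 'I_n -> set (measurableTypeR R)) :
  (forall i, measurable (A i)) ->
  measurable [set x : 'rV[R]_n | forall i, A i (x ord0 i)].
Proof.
move=> mA.
rewrite (_ : [set _ | _] =
  \big[setI/setT]_(i < n) [set x : 'rV[R]_n | A i (x ord0 i)]); last first.
  rewrite -bigcap_seq; apply/seteqP; split => [x /= Ax i _ //|x /= Ax i].
  by apply: Ax; rewrite /= mem_index_enum.
apply: bigsetI_measurable => i _; rewrite -[X in measurable X]setTI.
exact: measurable_coord_rV.
Qed.

End measurable_rV.

(* (t, (x_1, ..., x_n)) |-> (t, x_1, ..., x_n) *)
Definition cons_rV (R : realType) (n : nat)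
    (p : measurableTypeR R * 'rV[R]_n) : 'rV[R]_n.+1 :=
  \row_i oapp (fun j => p.2 ord0 j) p.1 (unlift ord0 i).

Section cons_rV.
Variables (R : realType) (n : nat).

Lemma cons_rV0 (p : measurableTypeR R * 'rV[R]_n) : cons_rV p ord0 ord0 = p.1.
Proof. by rewrite mxE unlift_none. Qed.

Lemma cons_rVS (p : measurableTypeR R * 'rV[R]_n) (j : 'I_n) :
  cons_rV p ord0 (lift ord0 j) = p.2 ord0 j.
Proof. by rewrite mxE liftK. Qed.

Lemma measurable_cons_rV :
  measurable_fun setT (@cons_rV R n).
Proof.
apply: measurable_fun_rVP => i; case: (unliftP ord0 i) => [j ->|->].
  under eq_fun do rewrite cons_rVS.
  exact: (measurableT_comp (@measurable_coord_rV R n j) measurable_snd).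
by under eq_fun do rewrite cons_rV0; exact: measurable_fst.
Qed.

Lemma measurable_uncons_rV : measurable_fun setT
  (fun x : 'rV[R]_n.+1 => (x ord0 ord0 : measurableTypeR R,
                           \row_j x ord0 (lift ord0 j) : 'rV[R]_n)).
Proof.
apply: measurable_fun_pair; first exact: measurable_coord_rV.
apply: measurable_fun_rVP => i; under eq_fun do rewrite mxE.
exact: measurable_coord_rV.
Qed.

Lemma cons_rVK (p : measurableTypeR R * 'rV[R]_n) :
  (cons_rV p ord0 ord0 : measurableTypeR R,
   \row_j cons_rV p ord0 (lift ord0 j)) = p.
Proof.
case: p => a v; rewrite cons_rV0; congr pair.
by apply/rowP => j; rewrite mxE cons_rVS.
Qed.

End cons_rV.

Section lebesgue_succ.
Local Open Scope ereal_scope.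
Variables (R : realType) (n : nat).
Variable mu : {sigma_finite_measure set 'rV[R]_n -> \bar R}.

Definition lebesgue_succ : set 'rV[R]_n.+1 -> \bar R :=
  pushforward (@lebesgue_measure R \x mu) (@cons_rV R n).

Let m A (mA : measurable A) : measurable (@cons_rV R n @^-1` A).
Proof. by rewrite -[X in measurable X]setTI; exact: measurable_cons_rV. Qed.

Let lebesgue_succ0 : lebesgue_succ set0 = 0.
Proof. by rewrite /lebesgue_succ /pushforward preimage_set0 measure0. Qed.

Let lebesgue_succ_ge0 A : 0 <= lebesgue_succ A.
Proof. by apply: integral_ge0 => x _; exact: measure_ge0. Qed.

Let lebesgue_succ_sigma_additive : semi_sigma_additive lebesgue_succ.
Proof.
move=> F mF tF mUF; rewrite /lebesgue_succ /pushforward preimage_bigcup.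
apply: measure_semi_sigma_additive; first by move=> k; exact: m.
- apply/trivIsetP => i j _ _ ij; rewrite -preimage_setI.
  by move/trivIsetP : tF => /(_ _ _ _ _ ij) ->//; rewrite preimage_set0.
- by rewrite -preimage_bigcup; exact: m.
Qed.

HB.instance Definition _ := isMeasure.Build _ _ _ lebesgue_succ
  lebesgue_succ0 lebesgue_succ_ge0 lebesgue_succ_sigma_additive.

Let lebesgue_succ_sigma_finite : sigma_finite setT lebesgue_succ.
Proof.
have /sigma_finiteP[F [TF ndF Foo]] := sigma_finiteT (@lebesgue_measure R).
have /sigma_finiteP[G [TG ndG Goo]] := sigma_finiteT mu.
pose g (x : 'rV[R]_n.+1) := (x ord0 ord0 : measurableTypeR R,
                             \row_j x ord0 (lift ord0 j) : 'rV[R]_n).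
exists (fun k => g @^-1` (F k `*` G k)).
  apply/esym; rewrite -subTset => x _.
  have [k _ Fk] : (\bigcup_k F k) (g x).1 by rewrite -TF.
  have [l _ Gl] : (\bigcup_k G k) (g x).2 by rewrite -TG.
  exists (maxn k l) => //; split.
  - by move: Fk; exact/subsetPset/ndF/leq_maxl.
  - by move: Gl; exact/subsetPset/ndG/leq_maxr.
move=> k; have [mF Fk] := Foo k; have [mG Gk] := Goo k; split.
  rewrite -[X in measurable X]setTI; apply: measurable_uncons_rV => //.
  exact: measurableX.
rewrite /lebesgue_succ /pushforward -comp_preimage.
rewrite (_ : g \o _ = id); last by apply/funext => p; exact: cons_rVK.
rewrite preimage_id product_measure1E//.
by rewrite lte_mul_pinfty// ge0_fin_numE.
Qed.

HB.instance Definition _ := Measure_isSigmaFinite.Build _ _ _ lebesgue_succ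
  lebesgue_succ_sigma_finite.

End lebesgue_succ.

(* Lebesgue measure on R^n restricted to Borel sets: the n-fold product of the
   one-dimensional one; see lebesgue_rV_box. *)
Fixpoint lebesgue_rV (R : realType) (n : nat) :
    {sigma_finite_measure set 'rV[R]_n -> \bar R} :=
  match n with
  | 0 => dirac (0 : 'rV[R]_0)
  | n'.+1 => lebesgue_succ (lebesgue_rV R n')
  end.

Lemma lebesgue_rV_box (R : realType) (n : nat)
    (A : 'I_n -> set (measurableTypeR R)) :
  (forall i, measurable (A i)) ->
  lebesgue_rV R n [set x | forall i, A i (x ord0 i)] =
  (\prod_(i < n) lebesgue_measure (A i))%E.
Proof.
elim: n A => [|n IH] A mA.
  by rewrite big_ord0 /= diracE mem_set// => -[].
rewrite big_ord_recl /= /lebesgue_succ /pushforward.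
rewrite -(IH (fun i => A (lift ord0 i)))// -product_measure1E//; last first.
  exact: (@measurable_box R n (fun i => A (lift ord0 i))).
congr (_ _); apply/seteqP; split => [p /= Ap|p /= [A0 AS] i].
  by split => [|i]; [rewrite -cons_rV0|rewrite -cons_rVS].
by case: (unliftP ord0 i) => [j ->|->]; rewrite ?cons_rVS ?cons_rV0.
Qed.

Section calculus.
Variables (R : realType) (n : nat).
Implicit Types (u : 'rV[R]_n -> R) (x y : 'rV[R]_n) (Omega : set 'rV[R]_n).

(* The library norm `|x| on 'rV[R]_n is the maximum norm. *)
Definition dotv x y : R := \sum_i x ord0 i * y ord0 i.
Definition enorm x : R := Num.sqrt (dotv x x).

Definition partial (i : 'I_n) u : 'rV[R]_n -> R := 'D_(delta_mx ord0 i) u.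
Definition partials (s : seq 'I_n) u : 'rV[R]_n -> R := foldr partial u s.

Definition grad u x : 'rV[R]_n := \row_i partial i u x.
Definition laplacian u x : R := \sum_i partial i (partial i u) x.

(* At the origin, where x / |x| is undefined, this is 0. *)
Definition rad_deriv u x : R := dotv (grad u x) ((enorm x)^-1 *: x).

Definition smooth u : Prop := forall s : seq 'I_n,
  continuous (partials s u) /\
  forall (i : 'I_n) x, derivable (partials s u) x (delta_mx ord0 i).

(* An element of C_0^oo(Omega) is identified with its extension by zero. *)
Definition test_function Omega u : Prop :=
  [/\ smooth u, compact (closure [set x | u x != 0]) &
      closure [set x | u x != 0] `<=` Omega].

End calculus.

(* Only the values on ]0, +oo[ matter: derivability at t > 0 is local. *)
Definition smooth_pos (R : realType) (f : R -> R) : Prop :=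
  forall (k : nat) (t : R), 0 < t -> derivable (derive1n k f) t 1.

(* Main.v *)
Require Import Defs.
From mathcomp Require Import all_boot all_order all_algebra.
From mathcomp Require Import all_classical all_reals all_analysis.
From mathcomp Require Import measurable_realfun ring lra.

Set Implicit Arguments.
Unset Strict Implicit.
Unset Printing Implicit Defensive.

Import Order.TTheory GRing.Theory Num.Theory.
Import numFieldNormedType.Exports.

Local Open Scope classical_set_scope.
Local Open Scope ring_scope.

(** Write W = - H' + H (n-1)/t - H^2 >= V.  For a radial vector field
    X = K(|x|) x/|x| the field 2 (X.grad u) grad u - |grad u|^2 X has divergence
    2 (X.grad u) Lap u minus a quadratic form in grad u (Pohozaev).  Integrating
    the inequality (Lap u)^2 >= 2 (X.grad u) Lap u - (X.grad u)^2 therefore gives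
      int (Lap u)^2 >= int W_K (d_r u)^2 + E_K (|grad u|^2 - (d_r u)^2),
    W_K and E_K being W and E_1 with K in place of H.

    K = H itself may be singular at 0.  The Riccati inequality forces H >= 0,
    and K = H / (1 + c H t^(1-n)) with c > 0 satisfies W_K = rho^2 W and
    E_K >= rho^2 E_1, where rho = 1 / (1 + c H t^(1-n)); moreover
    0 <= K <= t^(n-1)/c, so X is C^1 on the whole space when n >= 5 and no
    boundary term appears at the origin.  As c decreases to 0, rho increases
    to 1, and monotone convergence yields the inequality for K = H.

    In (i) one drops E_1 >= 0; in (ii) E_1 = W + E_2 >= W, so that both
    coefficients dominate V. *)

(** * Lebesgue measure on R^n *)

Section measure_rV.
Variables (R : realType) (n : nat).
Implicit Types (f g : 'rV[R]_n -> R) (A : set 'rV[R]_n).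

Lemma nbhs_rVP (x : 'rV[R]_n) A :
  nbhs x A <->
  exists2 e : R, 0 < e & forall y : 'rV[R]_n,
    (forall i, `|x ord0 i - y ord0 i| < e) -> A y.
Proof.
split=> [/nbhs_ballP[e /= e0 eA]|[e e0 eA]].
  by exists e => // y xy; apply: eA; split=> // i j; rewrite (ord1 i); exact: xy.
by apply/nbhs_ballP; exists e => // y [_ xy]; apply: eA => i; exact: xy.
Qed.

(** The sigma-algebra is generated by the coordinates, so openness has to be brought down to boxes:
    an open set is the countable union of the boxes with rational centre and rational half-side that
    it contains. *)
Lemma open_measurable_rV A : open A -> measurable A.
Proof.
move=> oA.
pose U := {p : 'rV[rat]_n * rat |
  `[< [set y : 'rV[R]_n | forall i, `|ratr (p.1 ord0 i) - y ord0 i| < ratr p.2]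
      `<=` A >]}.
pose F (p : U) := [set y : 'rV[R]_n |
  forall i, `|ratr ((val p).1 ord0 i) - y ord0 i| < ratr (val p).2].
suff -> : A = \bigcup_p F p.
  apply: countable_bigcupT_measurable; first exact: countableP.
  move=> p.
  pose B (i : 'I_n) : set (measurableTypeR R) :=
    [set` `](ratr ((val p).1 ord0 i) - ratr (val p).2),
         (ratr ((val p).1 ord0 i) + ratr (val p).2)[%R].
  rewrite (_ : F p = [set x | forall i, B i (x ord0 i)]); last first.
    by apply/seteqP; split=> y /= H i; move: (H i);
       rewrite /B /= in_itv /= distrC ltr_distl.
  by apply: (@measurable_box R n B) => i; exact: measurable_itv.
apply/seteqP; split=> [x Ax|x [p _ Fp]]; last first.
  by move: (valP p) => /asboolP; apply; exact: Fp.
have /nbhs_rVP[e e0 eA] : nbhs x A by exact: open_nbhs_nbhs.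
(* With a rational half-side [r < e / 2] and a rational centre within [r] of [x], the box contains
   [x], and each of its points is within [e] of [x] by the triangle inequality. *)
have [r] := rat_in_itvoo (divr_gt0 e0 (ltr0n _ 2)).
rewrite in_itv/= => /andP[r0 re].
have H (i : 'I_n) : exists q : rat, `|ratr q - x ord0 i| < ratr r.
  have [q] := @rat_in_itvoo R (x ord0 i - ratr r) (x ord0 i + ratr r) ltac:(lra).
  by rewrite in_itv/= => qr; exists q; rewrite ltr_distl.
have [q Hq] := choice H.
pose p0 : 'rV[rat]_n * rat := (\row_i q i, r).
have P0 : `[< [set y : 'rV[R]_n |
    forall i, `|ratr (p0.1 ord0 i) - y ord0 i| < ratr p0.2] `<=` A >].
  apply/asboolP => y /= yA; apply: eA => i.
  rewrite -(subrKA (ratr (q i))); have := yA i; rewrite mxE => h.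
  rewrite (le_lt_trans (ler_normD _ _))// distrC.
  by have := Hq i; lra.
by exists (exist _ p0 P0) => //= i; rewrite /F /= mxE; exact: Hq.
Qed.

Lemma continuous_measurable_rV f : continuous f ->
  measurable_fun setT (f : 'rV[R]_n -> measurableTypeR R).
Proof.
move=> /continuousP cf; apply: (measurability _ (RGenOpens.measurableE R)).
move=> _ [_ [a [b ->] <-]]; rewrite setTI.
by apply: open_measurable_rV; apply: cf; exact: interval_open.
Qed.

(** The cube [D] of half-side [M] is compact and has finite measure, and [f] is bounded on it and
    zero elsewhere. From here on compact support is used in this form, as a bound on the
    coordinates. *)
Lemma continuous_supp_integrable f (M : R) : continuous f ->
  (forall x, f x != 0 -> forall i, `|x ord0 i| <= M) ->
  (lebesgue_rV R n).-integrable setT (EFin \o f).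
Proof.
move=> cf suppf.
pose B (i : 'I_n) : set (measurableTypeR R) := `[- M, M]%classic.
pose D := [set x : 'rV[R]_n | forall i, B i (x ord0 i)].
have mB i : measurable (B i) by exact: measurable_itv.
have mD : measurable D by exact: measurable_box.
have Doo : (lebesgue_rV R n D < +oo)%E.
  have : (\prod_(i < n) lebesgue_measure (B i))%E \is a fin_num.
    elim/big_ind : _ => [//|x y|i _]; first exact: fin_numM.
    by rewrite /B lebesgue_measure_itv/=; case: ifP.
  by rewrite (lebesgue_rV_box mB) ltey_eq => ->.
rewrite (_ : EFin \o f = (EFin \o f) \_ D); last first.
  apply/funext => x; rewrite patchE; case: ifPn => // xD.
  have [fx|fx] := eqVneq (f x) 0; first by rewrite /= fx.
  move: xD; rewrite notin_setE => -[i]; rewrite /B /= in_itv /= -ler_norml.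
  exact: suppf.
apply/(integrable_mkcond _ mD).1; apply: measurable_bounded_integrable => //.
- by apply: measurable_funTS; exact: continuous_measurable_rV.
- have cD : compact D by apply: rV_compact => i; exact: segment_compact.
  have := continuous_compact (continuous_subspaceT cf) cD.
  by move=> /compact_bounded [N [Nr Nf]]; exists N; split=> // K NK x Dx;
     apply: (Nf K NK); exists x.
Qed.

End measure_rV.

(** * Fubini's theorem for splitting off the first coordinate *)

Section fubini_rV.
Local Open Scope ereal_scope.
Variables (R : realType) (n : nat) (f : 'rV[R]_n.+1 -> R).
Hypothesis intf : (lebesgue_rV R n.+1).-integrable setT (EFin \o f).

Let mu : {sigma_finite_measure set _ -> \bar R} := @lebesgue_measure R.
Let nu : {sigma_finite_measure set _ -> \bar R} := lebesgue_rV R n.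

Let intf_cons :
  (mu \x nu).-integrable setT (EFin \o f \o @cons_rV R n).
Proof.
have /integrableP[mf foo] := intf.
apply/integrableP; split.
  exact: (measurableT_comp mf (@measurable_cons_rV R n)).
move: foo; apply: le_lt_trans.
rewrite [leRHS](@ge0_integral_pushforward _ _ _ _ _ _
  (@measurable_cons_rV R n) (mu \x nu))//.
exact: measurableT_comp.
Qed.

Let integral_cons :
  \int[lebesgue_rV R n.+1]_x (f x)%:E =
  \int[mu \x nu]_p (f (cons_rV p))%:E.
Proof.
have /integrableP[mf _] := intf.
exact: (integral_pushforward (@measurable_cons_rV R n) mf intf_cons measurableT).
Qed.

Lemma integral_rV_succ :
  \int[lebesgue_rV R n.+1]_x (f x)%:E =
  \int[mu]_t \int[nu]_v (f (cons_rV (t, v)))%:E.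
Proof. by rewrite integral_cons -integral12_prod_meas1. Qed.

(** The order for differentiating in the first coordinate, which is then integrated innermost; the
    previous order serves the other coordinates. *)
Lemma integral_rV_succC :
  \int[lebesgue_rV R n.+1]_x (f x)%:E =
  \int[nu]_v \int[mu]_t (f (cons_rV (t, v)))%:E.
Proof. by rewrite integral_cons -integral21_prod_meas1. Qed.

End fubini_rV.

Lemma continuous_rV (R : realType) (T : topologicalType) n (F : T -> 'rV[R]_n) :
  (forall i, continuous (fun y => F y ord0 i)) -> continuous F.
Proof.
move=> cF x A /nbhs_rVP[e e0 eA].
have : \forall y \near x, forall i, `|F x ord0 i - F y ord0 i| < e.
  apply: filter_forall => i.
  by have /cvgrPdist_lt /(_ e e0) := cF i x.
by apply: filterS => y; exact: eA.
Qed.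

(** * Vanishing integrals of partial derivatives *)

Section partial_integral.
Variable R : realType.

(** The complement of the closed cube is open: if a coordinate of [x] exceeds [M] in absolute value,
    [f] vanishes on a whole neighbourhood of [x], of radius the excess, and so does its derivative
    at [x]. *)
Lemma partial_supp n (i : 'I_n) (f : 'rV[R]_n -> R) (M : R) :
  (forall x, f x != 0 -> forall j, `|x ord0 j| <= M) ->
  forall x, partial i f x != 0 -> forall j, `|x ord0 j| <= M.
Proof.
move=> suppf x fx j; rewrite leNgt; apply: contra fx => Mx; apply/eqP.
rewrite /partial -(derive_cst (0 : R) x (delta_mx ord0 i)).
apply: (@near_eq_derive _ _ _ f (cst 0) x); apply/nbhs_rVP.
exists (`|x ord0 j| - M); first by rewrite subr_gt0.
move=> y xy; have [//|/suppf/(_ j) fy] := eqVneq (f y) 0.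
have := xy j; have := ler_normD (x ord0 j - y ord0 j) (y ord0 j).
by rewrite subrK; lra.
Qed.

Lemma derive_cons_rV0 n (f : 'rV[R]_n.+1 -> R) (v : 'rV[R]_n) (t : R) :
  derivable f (cons_rV (t, v)) (delta_mx ord0 ord0) ->
  is_derive t 1 (fun s : R => f (cons_rV (s, v)))
    (partial ord0 f (cons_rV (t, v))).
Proof.
suff E : (fun h : R => h^-1 *: (((fun s : R => f (cons_rV (s, v))) \o shift t)
        (h *: 1) - f (cons_rV (t, v)))) =
      (fun h : R => h^-1 *: ((f \o shift (cons_rV (t, v)))
        (h *: delta_mx ord0 ord0) - f (cons_rV (t, v)))).
  by move=> df; split; rewrite /derivable /partial /derive E.
apply/funext => h /=; congr (_ *: (f _ - _)); apply/rowP => j.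
rewrite !mxE eqxx/=; case: (unliftP ord0 j) => [k ->|->].
  by rewrite /= mulr0 add0r.
by rewrite /= mulr1 [_%:A]mulr1.
Qed.

Lemma derive_cons_rVS n (f : 'rV[R]_n.+1 -> R) (i : 'I_n) (v : 'rV[R]_n)
    (t : R) :
  derivable f (cons_rV (t, v)) (delta_mx ord0 (lift ord0 i)) ->
  is_derive v (delta_mx ord0 i) (fun w => f (cons_rV (t, w)))
    (partial (lift ord0 i) f (cons_rV (t, v))).
Proof.
suff E : (fun h : R => h^-1 *: (((fun w => f (cons_rV (t, w))) \o shift v)
        (h *: delta_mx ord0 i) - f (cons_rV (t, v)))) =
      (fun h : R => h^-1 *: ((f \o shift (cons_rV (t, v)))
        (h *: delta_mx ord0 (lift ord0 i)) - f (cons_rV (t, v)))).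
  by move=> df; split; rewrite /derivable /partial /derive E.
apply/funext => h /=; congr (_ *: (f _ - _)); apply/rowP => j.
rewrite !mxE eqxx/=; case: (unliftP ord0 j) => [k ->|->].
  by rewrite /= !mxE (inj_eq lift_inj).
by rewrite /= mulr0 add0r.
Qed.

Lemma integral_derive0 (f f' : R -> R) (M : R) :
  (forall t : R, is_derive t (1 : R) f (f' t)) -> continuous f' ->
  (forall t, f t != 0 -> `|t| <= M) ->
  (\int[lebesgue_measure]_t (f' t)%:E = 0)%E.
Proof.
move=> df cf' suppf.
have cf : continuous f.
  move=> t; apply: differentiable_continuous; apply/derivable1_diffP.
  exact: ex_derive.
(* The margin 1 makes [f] vanish at both endpoints of the interval from [- N] to [N]; the absolute
   value keeps this interval nondegenerate even for negative [M]. *)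
pose N := `|M| + 1.
have N0 : 0 < N by rewrite ltr_pwDr.
have f0 t : N <= `|t| -> f t = 0.
  move=> Nt; apply/eqP; apply: contraTT Nt => /suppf tM.
  by rewrite -ltNge /N (le_lt_trans tM)// (le_lt_trans (ler_norm M))// ltrDl.
have f'0 t : N < `|t| -> f' t = 0.
  move=> Nt; rewrite -(@derive_val _ _ _ _ _ _ _ (df t)).
  rewrite -(derive_cst (0 : R) t 1).
  apply: near_eq_derive.
  have : \forall s \near t, N < `|s|.
    have := @norm_continuous _ R t; move/cvgr_gt; exact.
  by apply: filterS => s /ltW/f0.
rewrite (_ : (fun t => _) = (EFin \o f') \_ `[- N, N]); last first.
  apply/funext => t; rewrite patchE; case: ifPn => // xD /=.
  move: xD; rewrite notin_setE/= in_itv/= -ler_norml => /negP.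
  by rewrite -ltNge => /f'0 ->.
rewrite -integral_mkcond (continuous_FTC2 (F := f)).
- by rewrite !f0 ?subee// ?normrN ger0_norm// ltW.
- by rewrite (lt_trans _ N0)// oppr_lt0.
- exact: continuous_subspaceT.
- by split; [move=> x _; exact: ex_derive|apply: cvg_at_right_filter; exact: cf
     |apply: cvg_at_left_filter; exact: cf].
- by move=> x _; rewrite derive1E; exact: derive_val.
Qed.

(** Induction on the dimension. For a later coordinate, fix the first one and apply the induction
    hypothesis to the slice; for the first coordinate, the innermost integral vanishes by the
    fundamental theorem of calculus. *)
Lemma integral_partial n (i : 'I_n) (f : 'rV[R]_n -> R) (M : R) :
  (forall x, derivable f x (delta_mx ord0 i)) -> continuous (partial i f) ->
  (forall x, f x != 0 -> forall j, `|x ord0 j| <= M) ->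
  (\int[lebesgue_rV R n]_x (partial i f x)%:E = 0)%E.
Proof.
elim: n i f => [[]//|n IH] i f df cf suppf.
have intf := continuous_supp_integrable cf (partial_supp suppf).
case: (unliftP ord0 i) => [j|] ij; rewrite {i}ij in df cf intf *.
  rewrite (integral_rV_succ intf); apply: integral0_eq => t _.
  have E v := derive_cons_rVS (df (cons_rV (t, v))).
  have -> : (fun v => (partial (lift ord0 j) f (cons_rV (t, v)))%:E) =
            (fun v => (partial j (fun w => f (cons_rV (t, w))) v)%:E).
    apply/funext => v; congr (_%:E).
    exact/esym/(@derive_val _ _ _ _ _ _ _ (E v)).
  apply: IH => [v| |v fv k].
  - exact: ex_derive.
  - have -> : partial j (fun w => f (cons_rV (t, w))) =
              partial (lift ord0 j) f \o (fun w => cons_rV (t, w)).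
      by apply/funext => v; exact: (@derive_val _ _ _ _ _ _ _ (E v)).
    move=> v; apply: continuous_comp; last exact: cf.
    apply: continuous_rV => k w.
    case: (unliftP ord0 k) => [l ->|->].
      under eq_fun do rewrite cons_rVS; exact: coord_continuous.
    by under eq_fun do rewrite cons_rV0; exact: cst_continuous.
  - by have := suppf _ fv (lift ord0 k); rewrite cons_rVS.
rewrite (integral_rV_succC intf); apply: integral0_eq => v _.
apply: (@integral_derive0 (fun t => f (cons_rV (t, v))) _ M) => [t| |t ft].
- exact: derive_cons_rV0.
- move=> t.
  apply: (continuous_comp (f := fun t => cons_rV (t, v)) (g := partial ord0 f));
    last exact: cf.
  apply: continuous_rV => k w.
  case: (unliftP ord0 k) => [l ->|->].
    by under eq_fun do rewrite cons_rVS; exact: cst_continuous.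
  by under eq_fun do rewrite cons_rV0; exact: cvg_id.
- by have := suppf _ ft ord0; rewrite cons_rV0.
Qed.

End partial_integral.

(** * Directional derivatives and Schwarz's theorem *)

Section directional.
Variables (R : realType) (V : normedModType R).
Implicit Types (f g : V -> R) (x v w : V).

(** Both difference quotients are the same function of the increment. This transfers the
    one-variable chain rule and mean value theorem to derivatives along [v]. *)
Lemma is_derive_line f x v (s df : R) :
  is_derive (s *: v + x) v f df <->
  is_derive s (1 : R) (fun h => f (h *: v + x)) df.
Proof.
suff E : (fun h : R => h^-1 *: ((f \o shift (s *: v + x)) (h *: v)
        - f (s *: v + x))) =
    (fun h : R => h^-1 *: (((fun r : R => f (r *: v + x)) \o shift s) (h *: 1)
        - f (s *: v + x))).
  by split=> -[H1 H2]; split; move: H1 H2; rewrite /derivable /derive E.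
apply/funext => h /=; congr (_ *: (f _ - _)).
by rewrite [_%:A]mulr1 scalerDl addrA.
Qed.

Lemma is_derive_addl f x v c (df : R) :
  is_derive (c + x) v f df -> is_derive x v (fun y => f (c + y)) df.
Proof.
suff E : (fun h : R => h^-1 *: (((fun y => f (c + y)) \o shift x) (h *: v)
        - f (c + x))) =
    (fun h : R => h^-1 *: ((f \o shift (c + x)) (h *: v) - f (c + x))).
  by move=> [H1 H2]; split; move: H1 H2; rewrite /derivable /derive E.
by apply/funext => h /=; rewrite addrCA.
Qed.

Lemma is_derive_comp1 f (g : R -> R) x v (df dg : R) :
  is_derive x v f df -> is_derive (f x) (1 : R) g dg ->
  is_derive x v (fun y => g (f y)) (dg * df).
Proof.
move=> Df Dg; have E : x = 0 *: v + x by rewrite scale0r add0r.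
rewrite E in Df Dg *; apply/is_derive_line; move/is_derive_line : Df => Df.
exact: (is_derive1_comp Dg Df).
Qed.

Lemma is_derive_funM f g x v (df dg : R) :
  is_derive x v f df -> is_derive x v g dg ->
  is_derive x v (fun y => f y * g y) (f x * dg + df * g x).
Proof.
by move=> Df Dg; apply: is_derive_eq; rewrite [_ *: df]mulrC.
Qed.

Lemma is_derive_funB f g x v (df dg : R) :
  is_derive x v f df -> is_derive x v g dg ->
  is_derive x v (fun y => f y - g y) (df - dg).
Proof. by move=> Df Dg; exact: is_deriveB. Qed.

Lemma is_derive_funsum n (f : 'I_n -> V -> R) x v (df : 'I_n -> R) :
  (forall j, is_derive x v (f j) (df j)) ->
  is_derive x v (fun y => \sum_j f j y) (\sum_j df j).
Proof.
move=> Df; have := is_derive_sum Df.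
rewrite (_ : \sum_j f j = fun y => \sum_j f j y)//.
by apply/funext => y; rewrite fct_sumE.
Qed.

Lemma MVT_line f x v (h : R) : 0 < h -> (forall y, derivable f y v) ->
  exists2 s, 0 < s < h & f (h *: v + x) - f x = h * 'D_v f (s *: v + x).
Proof.
move=> h0 df.
have D s : is_derive s (1 : R) (fun h => f (h *: v + x)) ('D_v f (s *: v + x)).
  by apply/is_derive_line/derivableP.
have [|s sh] := MVT h0 (fun s _ => D s).
  apply: continuous_subspaceT => s; apply: differentiable_continuous.
  exact/derivable1_diffP/ex_derive.
by rewrite scale0r add0r subr0 mulrC => E; exists s => //; rewrite in_itv in sh.
Qed.

(** The mean value theorem is applied twice: along [v] to [f (h *: w + y) - f y], then along [w] to
    ['D_v f]. *)
Lemma double_difference f x v w (h : R) : 0 < h ->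
  (forall y, derivable f y v) -> (forall y, derivable ('D_v f) y w) ->
  exists s t, [/\ 0 < s < h, 0 < t < h &
    f (h *: v + (h *: w + x)) - f (h *: v + x) - (f (h *: w + x) - f x) =
    h ^+ 2 * 'D_w ('D_v f) (s *: v + (t *: w + x))].
Proof.
move=> h0 df d2f.
have D y : is_derive y v (fun y => f (h *: w + y) - f y)
                     ('D_v f (h *: w + y) - 'D_v f y).
  exact: is_derive_funB (is_derive_addl (derivableP (df _)))
    (derivableP (df _)).
have [s s0] := MVT_line x h0 (fun y => @ex_derive _ _ _ _ _ _ _ (D y)).
rewrite derive_val; have [t t0 ->] := MVT_line (s *: v + x) h0 d2f.
move=> E; exists s, t; split => //.
by rewrite ![h *: v + (_ + _)]addrCA E mulrA expr2 ![s *: v + (_ + _)]addrCA.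
Qed.

End directional.

Section partials.
Variables (R : realType) (n : nat).
Implicit Types (u f : 'rV[R]_n -> R) (x : 'rV[R]_n) (i j : 'I_n).

(** Used to keep the intermediate points of [double_difference] in a prescribed neighbourhood of
    [x]; it is continuity of the two-parameter displacement at the origin. *)
Lemma nbhs_two_steps x (P : set 'rV[R]_n) v w : nbhs x P ->
  exists2 h : R, 0 < h &
    forall s t : R, 0 < s < h -> 0 < t < h -> P (s *: v + (t *: w + x)).
Proof.
move=> xP.
pose F (p : R * R) := p.1 *: v + (p.2 *: w + x).
have cF : F @ nbhs ((0 : R), (0 : R)) --> F (0, 0).
  apply: cvgD; first by apply: cvgZr_tmp; exact: cvg_fst.
  by apply: cvgD; [apply: cvgZr_tmp; exact: cvg_snd|exact: cvg_cst].
rewrite /F/= !scale0r !add0r in cF.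
have [[A B] [/= /nbhs_ballP[a /= a0 aA] /nbhs_ballP[b /= b0 bB]] AB] := cF _ xP.
exists (Num.min a b); first by rewrite lt_min a0.
move=> s t; rewrite !lt_min => /and3P[s0 sa _] /and3P[t0 _ tb].
apply: (AB (s, t)); split=> /=.
  by apply: aA; rewrite /ball/= sub0r normrN gtr0_norm.
by apply: bB; rewrite /ball/= sub0r normrN gtr0_norm.
Qed.

(* The two mixed partials agree at points arbitrarily close to x, since the
   double difference of u is h^2 times either of them. *)
Lemma schwarz u i j x :
  (forall y, derivable u y (delta_mx ord0 i)) ->
  (forall y, derivable u y (delta_mx ord0 j)) ->
  (forall y, derivable (partial i u) y (delta_mx ord0 j)) ->
  (forall y, derivable (partial j u) y (delta_mx ord0 i)) ->
  {for x, continuous (partial j (partial i u))} ->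
  {for x, continuous (partial i (partial j u))} ->
  partial i (partial j u) x = partial j (partial i u) x.
Proof.
set v := delta_mx ord0 i; set w := delta_mx ord0 j.
move=> dvu dwu dwvu dvwu cwv cvw.
apply/eqP; rewrite -subr_eq0 -normr_eq0; apply/negPn/negP => d0.
have {}d0 : 0 < `|partial i (partial j u) x - partial j (partial i u) x|.
  by rewrite lt_def d0/=.
set d := `|_ - _| in d0.
have d2 : 0 < d / 2 by rewrite divr_gt0.
have P1 : \forall y \near x,
    `|partial j (partial i u) x - partial j (partial i u) y| < d / 2.
  by have /cvgrPdist_lt /(_ _ d2) := cwv.
have P2 : \forall y \near x,
    `|partial i (partial j u) x - partial i (partial j u) y| < d / 2.
  by have /cvgrPdist_lt /(_ _ d2) := cvw.
have [h h0 Ph] := nbhs_two_steps v w (filterI P1 P2).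
have [s [t [sh th E]]] := double_difference x h0 dvu dwvu.
have [t' [s' [th' sh' E']]] := double_difference x h0 dwu dvwu.
have [/= A _] := Ph _ _ sh th.
have [/= _] := Ph _ _ sh' th'.
rewrite addrCA.
have -> : partial i (partial j u) (t' *: w + (s' *: v + x)) =
          partial j (partial i u) (s *: v + (t *: w + x)).
  have h2 : h ^+ 2 != 0 by rewrite expf_neq0// gt_eqF.
  apply: (mulfI h2); apply: etrans (esym E') (etrans _ E).
  by rewrite [h *: v + (_ + _)]addrCA; ring.
move=> B; move: B A; rewrite /d.
move: (partial i (partial j u) x) (partial j (partial i u) x)
  (partial j (partial i u) _) => a b c ac bc.
clear -ac bc; have := ler_distD c a b; rewrite (distrC c b); lra.
Qed.

End partials.

(** * The Pohozaev field of a radial multiplier *)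

Section flux.
Variables (R : realType) (n : nat) (u : 'rV[R]_n -> R) (g g' : R -> R).
Hypothesis smooth_u : smooth u.
Hypothesis dg : forall s : R, is_derive s (1 : R) g (g' s).
Hypothesis cg' : continuous g'.
Implicit Types (x : 'rV[R]_n) (i j : 'I_n).

Local Notation e i := (delta_mx (ord0 : 'I_1) i : 'rV[R]_n).

(** The Euler operator [x . grad u], that is, [|x|] times the radial derivative. Unlike the latter
    it is continuous at the origin. *)
Definition euler x := \sum_j x ord0 j * partial j u x.
Definition grad_sq x := \sum_j partial j u x * partial j u x.
(* With X = g(|x|^2) x, this is component i of 2 (X.grad u) grad u - |grad u|^2 X. *)
Definition flux i x :=
  2 * (g (dotv x x) * (euler x * partial i u x))
  - g (dotv x x) * (x ord0 i * grad_sq x).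

Lemma continuous_sum_fun (T : topologicalType) m (f : 'I_m -> T -> R) :
  (forall k, continuous (f k)) -> continuous (fun t => \sum_k f k t).
Proof.
move=> cf; rewrite (_ : (fun t => _) = \sum_k f k); last first.
  by apply/funext => t; rewrite fct_sumE.
elim/big_ind : _ => [|a b ca cb|k _]; [exact: cst_continuous| |exact: cf].
by move=> t; apply: cvgD; [exact: ca|exact: cb].
Qed.

Lemma continuous_funM (T : topologicalType) (f h : T -> R) :
  continuous f -> continuous h -> continuous (fun t => f t * h t).
Proof. by move=> cf ch t; apply: cvgM; [exact: cf|exact: ch]. Qed.

Lemma continuous_funD (T : topologicalType) (f h : T -> R) :
  continuous f -> continuous h -> continuous (fun t => f t + h t).
Proof. by move=> cf ch t; apply: cvgD; [exact: cf|exact: ch]. Qed.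

Lemma continuous_funB (T : topologicalType) (f h : T -> R) :
  continuous f -> continuous h -> continuous (fun t => f t - h t).
Proof. by move=> cf ch t; apply: cvgB; [exact: cf|exact: ch]. Qed.

Lemma continuous_dotv : continuous (fun x => dotv x x).
Proof.
by apply: continuous_sum_fun => j; apply: continuous_funM;
   exact: coord_continuous.
Qed.

Lemma is_derive_coord i j x : is_derive x (e i) (fun y => y ord0 j) (i == j)%:R.
Proof.
suff H : (fun h : R => h^-1 *: (((fun y : 'rV[R]_n => y ord0 j) \o shift x)
    (h *: e i) - x ord0 j)) @ 0^' --> ((i == j)%:R : R).
  by split; [apply/cvg_ex; exists (i == j)%:R|exact: cvg_lim H].
apply: cvg_near_cst; near=> h.
rewrite /= !mxE eqxx/= addrK [_ *: _]mulrA mulVf ?mul1r; first by rewrite eq_sym.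
by near: h; exact: nbhs_dnbhs_neq.
Unshelve. all: by end_near. Qed.

Lemma is_derive_dotv i x : is_derive x (e i) (fun y => dotv y y) (2 * x ord0 i).
Proof.
have := is_derive_funsum
  (fun j => is_derive_funM (is_derive_coord i j x) (is_derive_coord i j x)).
rewrite (_ : \sum__ _ = 2 * x ord0 i)//.
rewrite (bigD1 i)//= eqxx big1 => [|j /negPf ji].
  by rewrite mulr1 mul1r; ring.
by rewrite eq_sym ji mulr0 mul0r addr0.
Qed.

Let du j x i : is_derive x (e i) (partial j u) (partial i (partial j u) x).
Proof. by apply/derivableP; exact: (smooth_u [:: j]).2. Qed.

Let cu i : continuous (partial i u).
Proof. exact: (smooth_u [:: i]).1. Qed.

Let cuu i j : continuous (partial i (partial j u)).
Proof. exact: (smooth_u [:: i; j]).1. Qed.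

Lemma continuous_euler : continuous euler.
Proof.
apply: continuous_sum_fun => j.
by apply: continuous_funM; [exact: coord_continuous|exact: cu].
Qed.

Lemma continuous_grad_sq : continuous grad_sq.
Proof. by apply: continuous_sum_fun => j; apply: continuous_funM; exact: cu. Qed.

Let uC i j x : partial i (partial j u) x = partial j (partial i u) x.
Proof.
apply: schwarz => [y|y|y|y||]; last 2 first.
- exact: cuu.
- exact: cuu.
- exact: (smooth_u [::]).2.
- exact: (smooth_u [::]).2.
- exact: (smooth_u [:: i]).2.
- exact: (smooth_u [:: j]).2.
Qed.

Let deuler i x := partial i u x + \sum_j x ord0 j * partial i (partial j u) x.
Let dgrad_sq i x := \sum_j 2 * (partial j u x * partial i (partial j u) x).

Lemma is_derive_euler i x : is_derive x (e i) euler (deuler i x).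
Proof.
have := is_derive_funsum
  (fun j => is_derive_funM (is_derive_coord i j x) (du j x i)).
rewrite (_ : \sum__ _ = deuler i x)//.
rewrite big_split/= addrC; congr +%R.
rewrite (bigD1 i)//= eqxx big1 => [|j /negPf ji].
  by rewrite mul1r addr0.
by rewrite eq_sym ji mul0r.
Qed.

Lemma is_derive_grad_sq i x : is_derive x (e i) grad_sq (dgrad_sq i x).
Proof.
have := is_derive_funsum (fun j => is_derive_funM (du j x i) (du j x i)).
rewrite (_ : \sum__ _ = dgrad_sq i x)//.
by apply: eq_bigr => j _; ring.
Qed.

Let dflux i x :=
  2 * (g (dotv x x) * (euler x * partial i (partial i u) x
                       + deuler i x * partial i u x)
       + g' (dotv x x) * (2 * x ord0 i) * (euler x * partial i u x))
  - (g (dotv x x) * (x ord0 i * dgrad_sq i x + grad_sq x)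
     + g' (dotv x x) * (2 * x ord0 i) * (x ord0 i * grad_sq x)).

Lemma is_derive_flux i x : is_derive x (e i) (flux i) (dflux i x).
Proof.
have dG := is_derive_comp1 (is_derive_dotv i x) (dg (dotv x x)).
have d1 := is_derive_funM dG (is_derive_funM (is_derive_euler i x) (du i x i)).
have d2 := is_derive_funM dG
  (is_derive_funM (is_derive_coord i i x) (is_derive_grad_sq i x)).
have := is_derive_funB (is_derive_funM (is_derive_cst (2 : R) x (e i)) d1) d2.
by move=> H; apply: is_derive_eq H _; rewrite /dflux /cst eqxx mul0r addr0 mul1r.
Qed.

Lemma partial_fluxE i : partial i (flux i) = dflux i.
Proof.
by apply/funext => x; exact: (@derive_val _ _ _ _ _ _ _ (is_derive_flux i x)).
Qed.

Lemma continuous_partial_flux i : continuous (partial i (flux i)).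
Proof.
have cG : continuous (fun x => g (dotv x x)).
  move=> x; apply: continuous_comp; first exact: continuous_dotv.
  by apply: differentiable_continuous; apply/derivable1_diffP/ex_derive.
have cG' : continuous (fun x => g' (dotv x x)).
  by move=> x; apply: continuous_comp; [exact: continuous_dotv|exact: cg'].
have cx j : continuous (fun x => x ord0 j) by exact: coord_continuous.
have cS := continuous_euler; have cN := continuous_grad_sq.
have cdS : continuous (deuler i).
  apply: continuous_funD; first exact: cu.
  by apply: continuous_sum_fun => j; exact: continuous_funM.
have c2 : continuous (fun _ : 'rV[R]_n => 2 : R) by exact: cst_continuous.
have cdN : continuous (dgrad_sq i).
  by apply: continuous_sum_fun => j; do 2 apply: continuous_funM => //.
(* The expression [dflux] with its factors replaced by variables, so that the continuity rules stop
   at these factors. *)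
have aux (G G' S N dS dN u1 u2 y : 'rV[R]_n -> R) :
    continuous G -> continuous G' -> continuous S -> continuous N ->
    continuous dS -> continuous dN -> continuous u1 -> continuous u2 ->
    continuous y ->
    continuous (fun x => 2 * (G x * (S x * u2 x + dS x * u1 x)
        + G' x * (2 * y x) * (S x * u1 x))
      - (G x * (y x * dN x + N x) + G' x * (2 * y x) * (y x * N x))).
  by move=> *; apply: continuous_funB;
     do ?[assumption|apply: continuous_funM|apply: continuous_funD].
rewrite partial_fluxE.
exact: (aux _ _ _ _ _ _ _ _ _ cG cG' cS cN cdS cdN (@cu i) (@cuu i i) (cx i)).
Qed.

(** The Pohozaev identity. The terms in [g'] come from [2 x_i g'], the gradient of [g (dotv x x)];
    the factor [n] is the divergence of [x], and [2 g grad_sq] comes from differentiating [x] inside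
    [euler]. *)
Lemma divergence_flux x :
  \sum_i partial i (flux i) x =
  4 * (g' (dotv x x) * euler x ^+ 2) + 2 * (g (dotv x x) * grad_sq x)
  + 2 * (g (dotv x x) * (euler x * laplacian u x))
  - 2 * (g' (dotv x x) * (dotv x x * grad_sq x))
  - n%:R * (g (dotv x x) * grad_sq x).
Proof.
set G := g _; set G' := g' _; set N := grad_sq x; set S := euler x.
pose T i := \sum_j x ord0 j * partial i (partial j u) x.
pose Z i := \sum_j partial j u x * partial i (partial j u) x.
(* Symmetry of the Hessian: the mixed second-order terms from the two halves of the flux cancel, and
   the only second derivatives left are those in the Laplacian. *)
have TZ : \sum_i T i * partial i u x = \sum_i x ord0 i * Z i.
  rewrite /T /Z; under eq_bigr do rewrite mulr_suml.
  under [RHS]eq_bigr do rewrite mulr_sumr.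
  rewrite exchange_big/=; apply: eq_bigr => i _; apply: eq_bigr => j _.
  by rewrite uC; ring.
transitivity (\sum_i (4 * G' * S * (x ord0 i * partial i u x)
    + 2 * G * (partial i u x * partial i u x)
    + 2 * G * (T i * partial i u x)
    + 2 * G * S * partial i (partial i u) x
    - 2 * G' * N * (x ord0 i * x ord0 i) - G * N - 2 * G * (x ord0 i * Z i))).
  apply: eq_bigr => i _; rewrite partial_fluxE /dflux /deuler /dgrad_sq.
  by rewrite -mulr_sumr -/(T i) -/(Z i) -/G -/G' -/N -/S; ring.
rewrite !sumrB !big_split/= -!mulr_sumr TZ sumr_const card_ord -mulr_natl.
rewrite -/(laplacian u x) -/(dotv x x) -/(euler x) -/(grad_sq x) -/S -/N.
by ring.
Qed.

Lemma flux_supp (M : R) :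
  (forall x, u x != 0 -> forall j, `|x ord0 j| <= M) ->
  forall i x, flux i x != 0 -> forall j, `|x ord0 j| <= M.
Proof.
move=> suppu i x Fx j; rewrite leNgt; apply: contra Fx => Mx.
have ux k : partial k u x = 0.
  apply/eqP; apply: contraTT Mx => kx; rewrite -leNgt.
  exact: partial_supp suppu _ kx j.
rewrite /flux ux !mulr0 sub0r oppr_eq0 /grad_sq big1 ?mulr0// => k _.
by rewrite ux mulr0.
Qed.

Lemma integral_divergence_flux (M : R) :
  (forall x, u x != 0 -> forall j, `|x ord0 j| <= M) ->
  (\int[lebesgue_rV R n]_x (\sum_i partial i (flux i) x)%:E = 0)%E.
Proof.
move=> suppu.
have suppF := flux_supp suppu.
under eq_integral do rewrite -sumEFin.
rewrite integral_sum//= => [|i].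
  apply: big1 => i _; apply: (integral_partial (M := M)) => //.
  - by move=> x; exact: (@ex_derive _ _ _ _ _ _ _ (is_derive_flux i x)).
  - exact: continuous_partial_flux.
  - exact: suppF.
apply: (@continuous_supp_integrable _ _ (partial i (flux i)) M).
  exact: continuous_partial_flux.
by apply: partial_supp; exact: suppF.
Qed.

End flux.

(** * The Riccati inequality *)

Section riccati.
Variable R : realType.
Implicit Types (f : R -> R) (t s : R).

Lemma is_derive_funV f t (df : R) : f t != 0 -> is_derive t (1 : R) f df ->
  is_derive t (1 : R) (fun y => (f y)^-1) (- df / f t ^+ 2).
Proof.
move=> ft [Df <-]; split; first exact: derivableV.
by rewrite deriveV// [LHS]mulNr [RHS]mulNr mulrC.
Qed.

Lemma is_derive_funX k t :
  is_derive t (1 : R) (fun y : R => y ^+ k) (k%:R * t ^+ k.-1).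
Proof.
by split; [exact: exprn_derivable|rewrite exp_derive [_ *: _]mulr1].
Qed.

Variables (H : R -> R) (n : nat).
Hypothesis n2 : (2 < n)%N.
Hypothesis dH : forall t, 0 < t -> derivable H t 1.

Let DH t : 0 < t -> is_derive t (1 : R) H (derive1 H t).
Proof. by move=> t0; rewrite derive1E; apply/derivableP/dH. Qed.

Hypothesis riccati_ge0 : forall t, 0 < t ->
  0 <= - derive1 H t + H t * ((n%:R - 1) / t) - H t ^+ 2.

Lemma within_continuous_derive (f df : R -> R) (a : R) :
  (forall t, a <= t -> is_derive t (1 : R) f (df t)) ->
  {within `[a, +oo[, continuous f}.
Proof.
move=> Df; apply: continuous_in_subspaceT => t; rewrite inE/= in_itv/= andbT.
move=> /Df Dt; apply: differentiable_continuous; apply/derivable1_diffP.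
exact: ex_derive.
Qed.

Lemma is_derive_homo (f df : R -> R) (a : R) :
  (forall t, a <= t -> is_derive t (1 : R) f (df t)) ->
  (forall t, a <= t -> 0 <= df t) ->
  forall t, a <= t -> f a <= f t.
Proof.
move=> Df df0 t at_; apply: (@ger0_derive1_ndecry _ f a) => //.
- by move=> s; rewrite in_itv/= andbT => /ltW /Df ?; exact: ex_derive.
- move=> s; rewrite in_itv/= andbT => /ltW as_; have Ds := Df _ as_.
  by rewrite derive1E (@derive_val _ _ _ _ _ _ _ Ds) df0.
- exact: within_continuous_derive Df.
Qed.

(* If H were negative at a, then H / t^(n-1) would decrease, so H would stay
   negative and 1 / H - t would increase, making 1 / H positive eventually. *)
Lemma riccati_nonneg t : 0 < t -> 0 <= H t.
Proof.
move=> a0; rewrite leNgt; apply/negP => Ha; set a := t in a0 Ha.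
have n1 : 0 <= n%:R - 1 :> R by rewrite subr_ge0 ler1n (leq_trans _ n2).
have pos s : a <= s -> 0 < s by exact: lt_le_trans.
have Hneg s : a <= s -> H s < 0.
  move=> as_; have s0 := pos _ as_.
  pose f y := 0 - H y * (y ^+ n.-1)^-1.
  have Df y : a <= y -> is_derive y (1 : R) f
      (0 - (H y * (- ((n.-1)%:R * y ^+ n.-2) / (y ^+ n.-1) ^+ 2)
            + derive1 H y * (y ^+ n.-1)^-1)).
    move=> /pos y0; apply: is_derive_funB.
    apply: is_derive_funM; first exact: DH.
    by apply: is_derive_funV; [rewrite expf_neq0// gt_eqF|exact: is_derive_funX].
  have := is_derive_homo Df _ as_.
  rewrite /f !sub0r lerN2 => fas.
  have : H s * (s ^+ n.-1)^-1 < 0.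
    apply: le_lt_trans (fas _) _; last by rewrite nmulr_rlt0// invr_gt0 exprn_gt0.
    move=> y /pos y0.
    have -> : 0 - (H y * (- ((n.-1)%:R * y ^+ n.-2) / (y ^+ n.-1) ^+ 2)
            + derive1 H y * (y ^+ n.-1)^-1) =
      (y ^+ n.-1)^-1 * ((- derive1 H y + H y * ((n%:R - 1) / y) - H y ^+ 2)
        + H y ^+ 2).
      case: n n2 => [|[|[|m]]]// _ /=.
      have y1 : y != 0 by rewrite gt_eqF.
      have ym : y ^+ m != 0 by rewrite expf_neq0.
      rewrite !exprS -[m.+3]addn1 -[m.+2]addn1 !natrD. field.
      by rewrite y1 ym.
    apply: mulr_ge0; first by rewrite invr_ge0 exprn_ge0// ltW.
    by rewrite addr_ge0 ?sqr_ge0 ?riccati_ge0.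
  by rewrite pmulr_llt0// invr_gt0 exprn_gt0.
pose f y := (H y)^-1 - y.
have Df y : a <= y -> is_derive y (1 : R) f (- derive1 H y / H y ^+ 2 - 1).
  move=> ay; apply: is_derive_funB; apply: is_derive_funV; last exact/DH/pos.
  by rewrite lt_eqF// Hneg.
(* Chosen so that monotonicity of [1 / H y - y] between [a] and [b] yields [1 / H b >= 1], against
   [H b < 0]. *)
pose b := a - (H a)^-1 + 1.
have ab : a <= b by have : (H a)^-1 < 0 by [rewrite invr_lt0]; rewrite /b; lra.
have := is_derive_homo Df _ ab; rewrite /f => fab.
have : (H b)^-1 < 0 by rewrite invr_lt0 Hneg.
suff : (H a)^-1 - a <= (H b)^-1 - b by rewrite /b; lra.
apply: fab => y ay; have y0 := pos _ ay; have Hy := Hneg _ ay.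
rewrite subr_ge0 ler_pdivlMr ?mul1r ?exprn_even_gt0 //= ?(lt_eqF Hy)//.
(* Dropping this nonpositive term from the Riccati inequality leaves [- H' >= H^2], so that [1 / H]
   has derivative at least 1. *)
have : H y * ((n%:R - 1) / y) <= 0.
  by apply: mulr_le0_ge0; [exact: ltW|apply: divr_ge0 => //; exact: ltW].
have := riccati_ge0 y0; lra.
Qed.

End riccati.

(** * The regularized multiplier as a C^1 function of |x|^2 *)

Section radial_profile.
Variable R : realType.
Implicit Types t s h : R.

Lemma cvg_sqrt_norm0 (C : R) : C * Num.sqrt `|h| @[h --> (0 : R)] --> (0 : R).
Proof.
rewrite -[X in _ --> X](_ : C * Num.sqrt `|0 : R| = 0); last first.
  by rewrite normr0 sqrtr0 mulr0.
apply: cvgM; first exact: cvg_cst.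
apply: (continuous_comp (f := @Num.norm R R)); first exact: norm_continuous.
exact: sqrt_continuous.
Qed.

Lemma cvg_le_sqrt_norm0 (f : R -> R) (C : R) (F : set_system R) {FF : Filter F} :
  F --> (0 : R) ->
  (\forall h \near F, `|f h| <= C * Num.sqrt `|h|) -> f @ F --> (0 : R).
Proof.
move=> F0 bf; have H : C * Num.sqrt `|h| @[h --> F] --> (0 : R).
  by apply: cvg_trans (@cvg_sqrt_norm0 C); exact: cvg_app.
apply/cvgr0Pnorm_lt => e e0; have /cvgr0Pnorm_lt /(_ e e0) := H.
apply: filterS2 bf => h fh; apply: le_lt_trans; rewrite (le_trans fh)//.
exact: ler_norm.
Qed.

(** The difference quotient is [O(|h|^(1/2))]. The exponent 3/2 in the bound is that of [t^3] in the
    variable [s = t^2]. *)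
Lemma is_derive0_bound (f : R -> R) (C : R) : f 0 = 0 ->
  (forall h, `|h| < 1 -> `|f h| <= C * `|h| * Num.sqrt `|h|) ->
  is_derive (0 : R) (1 : R) f 0.
Proof.
move=> f0 bf.
suff H : (fun h : R => h^-1 *: ((f \o shift 0) (h *: 1) - f 0)) @ 0^' --> (0 : R).
  by split; [apply/cvg_ex; exists 0|exact: cvg_lim H].
apply: (@cvg_le_sqrt_norm0 _ C); first exact: nbhs_dnbhs.
near=> h; rewrite /= f0 subr0 addr0 [h%:A]mulr1 [_ *: _]mulrC normrM normfV.
have h0 : h != 0 by near: h; exact: nbhs_dnbhs_neq.
rewrite ler_pdivrMr ?normr_gt0// mulrAC; apply: bf.
near: h; apply: nbhs_dnbhs; apply/nbhs_ballP; exists 1 => //= y.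
by rewrite /ball/= sub0r normrN.
Unshelve. all: by end_near. Qed.

Variables (H : R -> R) (n : nat) (c : R).
Hypotheses (n5 : (5 <= n)%N) (c0 : 0 < c).
Hypothesis dH : forall t, 0 < t -> derivable H t 1.
Hypothesis d2H : forall t, 0 < t -> derivable (derive1 H) t 1.

Let W t := - derive1 H t + H t * ((n%:R - 1) / t) - H t ^+ 2.
Let E1 t := derive1 H t + H t * ((n%:R - 3) / t).

Hypothesis W_ge0 : forall t, 0 < t -> 0 <= W t.
Hypothesis E1_ge0 : forall t, 0 < t -> 0 <= E1 t.

Let H_ge0 t : 0 < t -> 0 <= H t.
Proof. by apply: (@riccati_nonneg _ H n) => //; exact: leq_trans n5. Qed.

Let D t := t ^+ n.-1 + c * H t.
Let dD t := (n.-1)%:R * t ^+ n.-2 + c * derive1 H t.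

Let D_gt0 t : 0 < t -> 0 < D t.
Proof.
by move=> t0; rewrite ltr_pwDl ?exprn_gt0// mulr_ge0 ?(ltW c0) ?H_ge0.
Qed.

Let DH t : 0 < t -> is_derive t (1 : R) H (derive1 H t).
Proof. by move=> t0; rewrite derive1E; apply/derivableP/dH. Qed.

Let is_derive_D t : 0 < t -> is_derive t (1 : R) D (dD t).
Proof.
move=> t0.
have H1 := is_derive_funM (is_derive_cst c t (1 : R)) (DH t0).
have := is_deriveD (is_derive_funX n.-1 t) H1.
by move=> H2; apply: is_derive_eq H2 _; rewrite /cst mul0r addr0.
Qed.

(** This is [K t / t], with numerator and denominator of [K = H / (1 + c H t^(1-n))] multiplied by
    [t^(n-1)]. *)
Let a t := H t * t ^+ n.-2 * (D t)^-1.
Let da t := (H t * t ^+ n.-2) * (- dD t / D t ^+ 2) +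
  (H t * ((n.-2)%:R * t ^+ n.-2.-1) + derive1 H t * t ^+ n.-2) * (D t)^-1.

Let is_derive_a t : 0 < t -> is_derive t (1 : R) a (da t).
Proof.
move=> t0; apply: is_derive_funM.
  apply: is_derive_funM; first exact: DH.
  exact: is_derive_funX.
by apply: is_derive_funV; [rewrite gt_eqF// D_gt0|exact: is_derive_D].
Qed.

Let continuous_da t : 0 < t -> {for t, continuous da}.
Proof.
move=> t0.
have cH : H y @[y --> t] --> H t.
  by apply: differentiable_continuous; apply/derivable1_diffP/dH.
have cH' : derive1 H y @[y --> t] --> derive1 H t.
  by apply: differentiable_continuous; apply/derivable1_diffP/d2H.
have cX k : (fun y => y ^+ k) @ t --> t ^+ k by exact: exprn_continuous.
have cD : D y @[y --> t] --> D t.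
  by apply: cvgD; [exact: cX|apply: cvgM => //; exact: cvg_cst].
have D0 : D t != 0 by rewrite gt_eqF// D_gt0.
apply: cvgD; apply: cvgM.
- by apply: cvgM.
- apply: cvgM; first apply: cvgN; first apply: cvgD.
  + by apply: cvgM => //; exact: cvg_cst.
  + by apply: cvgM => //; exact: cvg_cst.
  + apply: cvgV; first by rewrite expf_neq0.
    by rewrite expr2; under eq_fun do rewrite expr2; exact: cvgM.
- apply: cvgD; last exact: cvgM.
  by apply: cvgM => //; apply: cvgM => //; exact: cvg_cst.
- exact: cvgV.
Qed.

Let rho t := t ^+ n.-1 / (t ^+ n.-1 + c * H t).

(** The left side is [- K' + K (n-1)/t - K^2] for [K = t a]. Where [H > 0], division by [K^2] gives
    [y' + (n-1) y / t - 1] with [y = 1 / K = 1 / H + c t^(1-n)]; since [t^(1-n)] solves the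
    homogeneous equation, the quotient is the same as for [H], and [rho = K / H]. *)
Let riccati_a t : 0 < t ->
  (n%:R - 2) * a t - t * da t - t ^+ 2 * a t ^+ 2 = rho t ^+ 2 * W t.
Proof.
move=> t0; have := D_gt0 t0; rewrite /rho /a /da /W /D /dD.
case: n n5 => [|[|[|m]]]//= _.
have tm : t ^+ m != 0 by rewrite expf_neq0// gt_eqF.
have tn : t != 0 by rewrite gt_eqF.
rewrite !exprS -[m.+3]addn1 -[m.+2]addn1 -[m.+1]addn1 !natrD.
move: (derive1 H t) (H t) (t ^+ m) tm => H' h p tm D0.
by field; rewrite tn gt_eqF.
Qed.

(** The left side is [K' + K (n-3)/t]. Divided by [K^2] it is [- y' + (n-3) y / t] with [y = 1 / K],
    and the summand [c t^(1-n)] of [y] contributes [2 (n-2) c t^(-n)], which is the nonnegative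
    remainder. *)
Let E_a t : 0 < t ->
  (n%:R - 2) * a t + t * da t = rho t ^+ 2 * E1 t
   + 2 * (n%:R - 2) * c * H t ^+ 2 * t ^+ n.-2 / D t ^+ 2.
Proof.
move=> t0; have := D_gt0 t0; rewrite /rho /a /da /E1 /D /dD.
case: n n5 => [|[|[|m]]]//= _.
have tm : t ^+ m != 0 by rewrite expf_neq0// gt_eqF.
have tn : t != 0 by rewrite gt_eqF.
rewrite !exprS -[m.+3]addn1 -[m.+2]addn1 -[m.+1]addn1 !natrD.
move: (derive1 H t) (H t) (t ^+ m) tm => H' h p tm D0.
by field; rewrite tn gt_eqF.
Qed.

Let n2_ge0 : 0 <= n%:R - 2 :> R.
Proof. by rewrite subr_ge0 ler_nat (leq_trans _ n5). Qed.

Let E_a_ge t : 0 < t -> rho t ^+ 2 * E1 t <= (n%:R - 2) * a t + t * da t.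
Proof.
move=> t0; rewrite E_a// lerDl divr_ge0 ?sqr_ge0//.
by rewrite !mulr_ge0 ?exprn_ge0 ?H_ge0// ltW.
Qed.

Let a_ge0 t : 0 < t -> 0 <= a t.
Proof.
by move=> t0; rewrite /a !mulr_ge0 ?invr_ge0 ?exprn_ge0 ?H_ge0// ltW// D_gt0.
Qed.

(** From [D >= c H] one gets [a <= t^(n-2) / c], and [n >= 5] gives the cube, hence order [s^(3/2)]
    in [s = t^2]. *)
Let a_le t : 0 < t -> t < 1 -> a t <= c^-1 * t ^+ 3.
Proof.
move=> t0 t1; rewrite /a ler_pdivrMr ?D_gt0//.
have tn : t ^+ n.-2 <= t ^+ 3.
  by apply: ler_wiXn2l; rewrite ?ltW//; case: n n5 => [|[|[|[|[|]]]]].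
apply: (@le_trans _ _ (c^-1 * t ^+ 3 * (c * H t))).
  rewrite [leRHS](_ : _ = H t * t ^+ 3); last by field; rewrite gt_eqF.
  by rewrite ler_wpM2l// H_ge0.
rewrite ler_wpM2l ?mulr_ge0 ?invr_ge0 ?exprn_ge0 ?(ltW c0) ?(ltW t0)//.
by rewrite /D lerDr exprn_ge0// ltW.
Qed.

(** The sign of [W] bounds [t * da t] from above and the sign of [E1] bounds it from below, so [da]
    is controlled by [a] without any estimate on [H']. *)
Let tda_le t : 0 < t -> `|t * da t| <= (n%:R - 2) * a t.
Proof.
move=> t0; have h1 := E_a_ge t0; have h2 := riccati_a t0.
have r1 : 0 <= rho t ^+ 2 * E1 t by rewrite mulr_ge0 ?sqr_ge0 ?E1_ge0.
have r2 : 0 <= rho t ^+ 2 * W t by rewrite mulr_ge0 ?sqr_ge0 ?W_ge0.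
have r3 : 0 <= t ^+ 2 * a t ^+ 2 by rewrite mulr_ge0 ?sqr_ge0.
by rewrite ler_norml; lra.
Qed.

(* g(t^2) = K(t) / t for the regularization K = H / (1 + c H t^(1-n)). *)
Lemma radial_profile : exists g g' : R -> R,
  [/\ forall s, is_derive s (1 : R) g (g' s), continuous g', g 0 = 0 &
   forall t, 0 < t -> [/\
     (n%:R - 2) * g (t ^+ 2) - 2 * t ^+ 2 * g' (t ^+ 2)
       - t ^+ 2 * g (t ^+ 2) ^+ 2 = rho t ^+ 2 * W t &
     rho t ^+ 2 * E1 t <=
       (n%:R - 2) * g (t ^+ 2) + 2 * t ^+ 2 * g' (t ^+ 2)]].
Proof.
(* Extension by zero to [s <= 0] gives a profile that is C^1 on the whole line, as the flux
   computation requires; [g'] is the chain rule for [s = t^2]. *)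
pose g s := if 0 < s then a (Num.sqrt s) else 0.
pose g' s := if 0 < s then da (Num.sqrt s) * (2 * Num.sqrt s)^-1 else 0.
have nearpos (s : R) : 0 < s -> \forall r \near s, 0 < r.
  by move=> s0; exact: lt_nbhsr.
have nearneg (s : R) : s < 0 -> \forall r \near s, r < 0.
  by move=> s0; exact: lt_nbhsl.
have gb (s : R) : `|s| < 1 -> `|g s| <= c^-1 * `|s| * Num.sqrt `|s|.
  rewrite /g; case: ifPn => [s0|_ _]; last first.
    by rewrite normr0 !mulr_ge0 ?invr_ge0 ?sqrtr_ge0// ltW.
  rewrite (gtr0_norm s0) => s1; have t0 : 0 < Num.sqrt s by rewrite sqrtr_gt0.
  rewrite (ger0_norm (a_ge0 t0)) (le_trans (a_le t0 _))//.
    by rewrite -sqrtr1 ltr_sqrt.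
  by rewrite -{2}(sqr_sqrtr (ltW s0)) -mulrA -exprSr.
(* With [t = sqrt s], [|da t| / (2 t) <= (n-2) a t / (2 t^2) <= (n-2) t / (2 c)]; the bound has a
   factor 2 to spare. *)
have g'b (s : R) : `|s| < 1 -> `|g' s| <= (n%:R - 2) * c^-1 * Num.sqrt `|s|.
  rewrite /g'; case: ifPn => [s0|_ _]; last first.
    by rewrite normr0 !mulr_ge0 ?invr_ge0 ?sqrtr_ge0// ltW.
  rewrite (gtr0_norm s0) => s1; have t0 : 0 < Num.sqrt s by rewrite sqrtr_gt0.
  have t1 : Num.sqrt s < 1 by rewrite -sqrtr1 ltr_sqrt.
  have := tda_le t0; have := a_le t0 t1; move: t0 t1.
  set t := Num.sqrt s => t0 t1 ha hda.
  rewrite normrM normfV (gtr0_norm (mulr_gt0 _ t0))// ler_pdivrMr ?mulr_gt0//.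
  rewrite -(ler_pM2l t0) -{1}(gtr0_norm t0) -normrM (le_trans hda)//.
  rewrite (le_trans (ler_wpM2l n2_ge0 ha))//.
  have : 0 <= (n%:R - 2) * (c^-1 * t ^+ 3).
    by rewrite !mulr_ge0 ?exprn_ge0 ?invr_ge0// ltW.
  have -> : t * ((n%:R - 2) * c^-1 * t * (2 * t)) =
    2 * ((n%:R - 2) * (c^-1 * t ^+ 3)) by ring.
  lra.
exists g, g'; split.
- move=> s; have [s0|s0|s0] := ltgtP s 0.
  + rewrite /g' ltNge (ltW s0)/=; apply: (near_eq_is_derive (f := cst 0)).
      by apply: filterS (nearneg _ s0) => r r0; rewrite /g ltNge (ltW r0).
  + have t0 : 0 < Num.sqrt s by rewrite sqrtr_gt0.
    rewrite /g' s0; apply: (near_eq_is_derive (f := a \o Num.sqrt)).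
      by apply: filterS (nearpos _ s0) => r r0; rewrite /g r0.
    exact: is_derive1_comp (is_derive_a t0) (is_derive1_sqrt s0).
  + rewrite s0 /g' ltxx; apply: is_derive0_bound gb.
    by rewrite /g ltxx.
- move=> s; rewrite /continuous_at; have [s0|s0|s0] := ltgtP s 0.
  + have -> : g' s = cst 0 s by rewrite /g' ltNge (ltW s0).
    have cf : cst (0 : R) r @[r --> s] --> cst (0 : R) s by exact: cvg_cst.
    apply: cvg_trans cf; apply: near_eq_cvg.
    by apply: filterS (nearneg _ s0) => r r0; rewrite /g' ltNge (ltW r0).
  + have t0 : 0 < Num.sqrt s by rewrite sqrtr_gt0.
    pose f r := da (Num.sqrt r) * (2 * Num.sqrt r)^-1.
    have cf : f r @[r --> s] --> f s.
      have cs := @sqrt_continuous R s.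
      apply: cvgM.
        by apply: (continuous_comp (f := Num.sqrt)) => //; exact: continuous_da.
      apply: cvgV; first by rewrite mulf_neq0// gt_eqF.
      by apply: cvgM => //; exact: cvg_cst.
    have -> : g' s = f s by rewrite /g' s0.
    apply: cvg_trans cf; apply: near_eq_cvg.
    by apply: filterS (nearpos _ s0) => r r0; rewrite /g' r0.
  + rewrite s0 {2}/g' ltxx.
    apply: (@cvg_le_sqrt_norm0 _ ((n%:R - 2) * c^-1)); first exact: cvg_id.
    apply/nbhs_ballP; exists 1 => //= r.
    by rewrite /ball/= sub0r normrN; exact: g'b.
- by rewrite /g ltxx.
- move=> t t0; rewrite /g /g' exprn_gt0// sqrtr_sqr (gtr0_norm t0).
  have -> : 2 * t ^+ 2 * (da t * (2 * t)^-1) = t * da t.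
    by field; rewrite gt_eqF.
  by split; [exact: riccati_a|exact: E_a_ge].
Qed.

End radial_profile.

(** * The Euclidean inner product and norm *)

Section dot_product.
Variables (R : realType) (n : nat).
Implicit Types x y : 'rV[R]_n.

Lemma dotv_ge0 x : 0 <= dotv x x.
Proof. by apply: sumr_ge0 => i _; exact: sqr_ge0. Qed.

Lemma dotv_eq0 x : (dotv x x == 0) = (x == 0).
Proof.
apply/idP/eqP => [|->]; last by rewrite /dotv big1// => i _; rewrite mxE mul0r.
rewrite /dotv psumr_eq0 => [/allP x0|i _]; last exact: sqr_ge0.
apply/rowP => i; have := x0 i (mem_index_enum i).
by rewrite /= mulf_eq0 orbb mxE => /eqP.
Qed.

Lemma enorm_gt0 x : (0 < enorm x) = (x != 0).
Proof. by rewrite sqrtr_gt0 lt_def dotv_eq0 dotv_ge0 andbT. Qed.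

Lemma enorm_sqr x : enorm x ^+ 2 = dotv x x.
Proof. by rewrite sqr_sqrtr// dotv_ge0. Qed.

Lemma continuous_enorm : continuous (@enorm R n).
Proof.
move=> x; apply: (continuous_comp (f := fun x => dotv x x)).
  exact: continuous_dotv.
exact: sqrt_continuous.
Qed.

Lemma cauchy_schwarz_dotv x y : dotv x y ^+ 2 <= dotv x x * dotv y y.
Proof.
have [x0|x0] := eqVneq (dotv x x) 0.
  move/eqP: (x0); rewrite dotv_eq0 => /eqP ->.
  have d0 z : dotv 0 z = 0 :> R by apply: big1 => i _; rewrite mxE mul0r.
  by rewrite !d0 expr0n mul0r.
have q0 : 0 < dotv x x by rewrite lt_def x0 dotv_ge0.
rewrite -subr_ge0 -(pmulr_rge0 _ q0).
(* The right side is the squared norm of [|x|^2 y - (x . y) x], a multiple of the component of [y]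
   orthogonal to [x]. *)
have -> : dotv x x * (dotv x x * dotv y y - dotv x y ^+ 2) =
    \sum_i (dotv x x * y ord0 i - dotv x y * x ord0 i) ^+ 2.
  transitivity (\sum_i (dotv x x ^+ 2 * (y ord0 i * y ord0 i)
    - 2 * dotv x x * dotv x y * (x ord0 i * y ord0 i)
    + dotv x y ^+ 2 * (x ord0 i * x ord0 i))).
    rewrite big_split/= sumrB -!mulr_sumr -/(dotv y y) -/(dotv x y).
    by rewrite -/(dotv x x); ring.
  by apply: eq_bigr => i _; ring.
by apply: sumr_ge0 => i _; exact: sqr_ge0.
Qed.

End dot_product.

(** * Supports of derivatives and null sets *)

Section support.
Variables (R : realType) (n : nat).
Implicit Types (u f : 'rV[R]_n -> R) (x : 'rV[R]_n).

(** Kept in neighbourhood form, so that it can be iterated to second derivatives. *)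
Lemma near_partial0 f i x : (\forall y \near x, f y = 0) ->
  \forall y \near x, partial i f y = 0.
Proof.
move=> /nbhs_interior; apply: filterS => y fy.
rewrite -(derive_cst (0 : R) y (delta_mx ord0 i)).
exact: (@near_eq_derive _ _ _ f (cst 0) y).
Qed.

Lemma near_off_closure u x : ~ closure [set y | u y != 0] x ->
  \forall y \near x, u y = 0.
Proof.
move=> xu; have : open (~` closure [set y | u y != 0]).
  by apply: closed_openC; exact: closed_closure.
rewrite openE => /(_ x xu); apply: filterS => y /= yu.
by apply/eqP/negPn/negP => uy; apply: yu; exact: subset_closure.
Qed.

Lemma compact_supp_bounded u : compact (closure [set y | u y != 0]) ->
  exists M : R, forall x, u x != 0 -> forall j, `|x ord0 j| <= M.
Proof.
move=> /compact_bounded [M [_ HM]]; exists (M + 1) => x ux j.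
have /= xM : `|x| <= M + 1.
  by apply: HM; [rewrite ltrDl|exact: subset_closure].
apply: le_trans xM; rewrite [leRHS]/Num.Def.normr /= mx_normrE.
by apply/bigmax_geP; right; exists (ord0, j).
Qed.

Lemma set1_rV x : [set x] = [set y | forall i, [set x ord0 i] (y ord0 i)].
Proof.
apply/seteqP; split=> [y -> i//|y /= xy]; apply/rowP => i; exact: xy.
Qed.

Lemma measurable_set1_rV x : measurable [set x].
Proof.
rewrite set1_rV.
apply: (@measurable_box R n (fun i => [set x ord0 i])) => i.
exact: measurable_set1.
Qed.

Lemma lebesgue_rV_set1 x : (0 < n)%N -> lebesgue_rV R n [set x] = 0%E.
Proof.
move=> n0; rewrite set1_rV.
rewrite (@lebesgue_rV_box R n (fun i => [set x ord0 i])) => [|i]; last first.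
  exact: measurable_set1.
by rewrite (bigD1 (Ordinal n0))//= lebesgue_measure_set1 mul0e.
Qed.

End support.

(** * The regularized inequality *)

Section radial_part.
Variables (R : realType) (n : nat) (u : 'rV[R]_n -> R).
Implicit Types x : 'rV[R]_n.

Lemma dotv_grad x : dotv x (grad u x) = euler u x.
Proof. by apply: eq_bigr => i _; rewrite mxE. Qed.

Lemma enorm_grad_sqr x : enorm (grad u x) ^+ 2 = grad_sq u x.
Proof. by rewrite enorm_sqr; apply: eq_bigr => i _; rewrite mxE. Qed.

Lemma rad_derivE x : rad_deriv u x = (enorm x)^-1 * euler u x.
Proof.
by rewrite mulr_sumr; apply: eq_bigr => i _; rewrite !mxE; ring.
Qed.

(** Cauchy-Schwarz; the difference of the two sides is the squared tangential part of the
    gradient. *)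
Lemma euler_sq_le x : x != 0 -> euler u x ^+ 2 / dotv x x <= grad_sq u x.
Proof.
move=> x0; have q0 : 0 < dotv x x by rewrite -enorm_sqr exprn_gt0// enorm_gt0.
rewrite ler_pdivrMr// mulrC -enorm_grad_sqr enorm_sqr -dotv_grad.
exact: cauchy_schwarz_dotv.
Qed.

End radial_part.

Section rellich.
Variables (R : realType) (n : nat) (u : 'rV[R]_n -> R) (H : R -> R).
Implicit Types (t s : R) (x : 'rV[R]_n).
Hypothesis n5 : (5 <= n)%N.
Hypothesis smooth_u : smooth u.
Hypothesis csupp_u : compact (closure [set x | u x != 0]).
Hypothesis dH : forall t, 0 < t -> derivable H t 1.
Hypothesis d2H : forall t, 0 < t -> derivable (derive1 H) t 1.

Local Notation W t := (- derive1 H t + H t * ((n%:R - 1) / t) - H t ^+ 2).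
Local Notation E1 t := (derive1 H t + H t * ((n%:R - 3) / t)).
Local Notation rho c t := (t ^+ n.-1 / (t ^+ n.-1 + c * H t)).

Hypothesis W_ge0 : forall t, 0 < t -> 0 <= W t.
Hypothesis E1_ge0 : forall t, 0 < t -> 0 <= E1 t.

Let continuous_laplacian : continuous (laplacian u).
Proof.
by apply: continuous_sum_fun => i; exact: (smooth_u [:: i; i]).1.
Qed.

(** The divergence of the flux integrates to zero, so subtracting it leaves the integral of the
    squared Laplacian unchanged and a pointwise bound suffices. *)
Lemma integral_ge_of_divergence (g g' : R -> R) (q : 'rV[R]_n -> R) :
  (forall s, is_derive s (1 : R) g (g' s)) -> continuous g' ->
  measurable_fun setT (q : 'rV[R]_n -> measurableTypeR R) ->
  (forall x, 0 <= q x) ->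
  (forall x, q x <= laplacian u x ^+ 2 - \sum_i partial i (flux u g i) x) ->
  (\int[lebesgue_rV R n]_x (q x)%:E <=
   \int[lebesgue_rV R n]_x (laplacian u x ^+ 2)%:E)%E.
Proof.
move=> dg cg' mq q0 qle.
have [M suppu] := compact_supp_bounded csupp_u.
pose dv x := \sum_i partial i (flux u g i) x.
have cdv : continuous dv.
  by apply: continuous_sum_fun => i; exact: continuous_partial_flux dg cg' _.
have cL2 : continuous (fun x => laplacian u x ^+ 2).
  rewrite (_ : (fun x => _) = (fun x => laplacian u x * laplacian u x)) //.
  exact: continuous_funM.
have suppd i x : partial i u x != 0 -> forall j, `|x ord0 j| <= M.
  exact: partial_supp suppu x.
have iL2 : (lebesgue_rV R n).-integrable setT
    (EFin \o (fun x => laplacian u x ^+ 2)).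
  apply: (@continuous_supp_integrable _ _ _ M) => // x.
  rewrite sqrf_eq0 => Lx j; rewrite leNgt; apply: contra Lx => Mx.
  rewrite /laplacian big1// => i _; apply/eqP; apply: contraTT Mx => ix.
  by rewrite -leNgt; exact: partial_supp (suppd i) _ ix j.
have idv : (lebesgue_rV R n).-integrable setT (EFin \o dv).
  apply: (@continuous_supp_integrable _ _ _ M) => // x.
  move=> dx j; rewrite leNgt; apply: contra dx => Mx.
  rewrite /dv big1// => i _; apply/eqP; apply: contraTT Mx => ix.
  rewrite -leNgt; apply: (partial_supp _ ix) => y Fy k.
  exact: flux_supp suppu _ _ Fy k.
rewrite -[leRHS]sube0 -(integral_divergence_flux smooth_u dg cg' suppu).
rewrite -integralB_EFin//; apply: ge0_le_integral => //.
- by move=> x _; rewrite lee_fin.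
- exact/measurable_EFinP.
- by apply: emeasurable_funB; [exact: measurable_int iL2|exact: measurable_int idv].
- by move=> x _; rewrite -EFinB lee_fin.
Qed.

(** When [w] and [e] equal their upper bounds, the two sides differ by the square of
    [laplacian u x - g (dotv x x) * euler u x]. The general case follows because the radial and
    tangential parts that [w] and [e] multiply are nonnegative. *)
Lemma le_laplacian_sq_sub_div (g g' : R -> R) (w e : R) x :
  (forall s, is_derive s (1 : R) g (g' s)) -> x != 0 ->
  w <= (n%:R - 2) * g (dotv x x) - 2 * dotv x x * g' (dotv x x)
       - dotv x x * g (dotv x x) ^+ 2 ->
  e <= (n%:R - 2) * g (dotv x x) + 2 * dotv x x * g' (dotv x x) ->
  w * (euler u x ^+ 2 / dotv x x)
    + e * (grad_sq u x - euler u x ^+ 2 / dotv x x)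
  <= laplacian u x ^+ 2 - \sum_i partial i (flux u g i) x.
Proof.
move=> dg x0 hw he.
have q0 : 0 < dotv x x by rewrite -enorm_sqr exprn_gt0// enorm_gt0.
have r0 : 0 <= euler u x ^+ 2 / dotv x x by rewrite divr_ge0 ?sqr_ge0 ?ltW.
have tau0 : 0 <= grad_sq u x - euler u x ^+ 2 / dotv x x.
  by rewrite subr_ge0 euler_sq_le.
apply: (le_trans (lerD (ler_wpM2r r0 hw) (ler_wpM2r tau0 he))).
rewrite (divergence_flux smooth_u dg).
rewrite -subr_ge0; move: r0 tau0 hw he => _ _ _ _.
set L := laplacian u x; set S := euler u x; set N := grad_sq u x.
set G := g _; set G' := g' _; set q := dotv x x in q0 *.
rewrite [leRHS](_ : _ = (L - G * S) ^+ 2) ?sqr_ge0//.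
by field; rewrite gt_eqF.
Qed.

(** The weight is factored as a radial [f], possibly singular at 0, times a continuous [Q], so that
    both inequalities become instances. Restriction to the positive half-line gives [q] the value 0
    at the origin and reduces its measurability to continuity of [rho] and [f] there. *)
Lemma rellich_regularized (f : R -> R) (Q : 'rV[R]_n -> R) (c : R) : 0 < c ->
  (forall t, 0 < t -> 0 <= f t) -> (forall t, 0 < t -> {for t, continuous f}) ->
  continuous Q -> (forall x, 0 <= Q x) ->
  (forall x, x != 0 -> f (enorm x) * Q x <=
    W (enorm x) * (euler u x ^+ 2 / dotv x x)
    + E1 (enorm x) * (grad_sq u x - euler u x ^+ 2 / dotv x x)) ->
  let q x := ((fun t => rho c t ^+ 2 * f t) \_ `]0, +oo[%classic) (enorm x) * Q x in
  measurable_fun setT (q : 'rV[R]_n -> measurableTypeR R) /\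
  (\int[lebesgue_rV R n]_x (q x)%:E <=
   \int[lebesgue_rV R n]_x (laplacian u x ^+ 2)%:E)%E.
Proof.
move=> c0 f0 cf cQ Q0 fle q.
have mq : measurable_fun setT (q : 'rV[R]_n -> measurableTypeR R).
  apply: measurable_funM; last exact: continuous_measurable_rV.
  apply: measurableT_comp; last first.
    by apply: continuous_measurable_rV; exact: continuous_enorm.
  apply/(measurable_restrictT _ _).1 => //.
  apply: open_continuous_measurable_fun; first exact: interval_open.
  move=> t; rewrite inE/= in_itv/= andbT => t0.
  have cH : H y @[y --> t] --> H t.
    by apply: differentiable_continuous; apply/derivable1_diffP/dH.
  have cX : (fun y => y ^+ n.-1) @ t --> t ^+ n.-1 by exact: exprn_continuous.
  have H0 : 0 <= H t.
    by apply: (@riccati_nonneg _ H n) => //; exact: leq_trans n5.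
  have cr : rho c y @[y --> t] --> rho c t.
    apply: cvgM => //; apply: cvgV.
      by rewrite gt_eqF// ltr_pwDl ?exprn_gt0// mulr_ge0// ltW.
    by apply: cvgD => //; apply: cvgM => //; exact: cvg_cst.
  by apply: cvgM; [exact: cvgM|exact: cf].
have qE x : x != 0 -> q x = rho c (enorm x) ^+ 2 * f (enorm x) * Q x.
  by move=> x0; rewrite /q patchE ifT// inE/= in_itv/= andbT enorm_gt0.
have q_0 x : x = 0 -> q x = 0.
  move=> ->; rewrite /q patchE ifF ?mul0r//.
  by apply/negbTE/negP; rewrite inE/= in_itv/= andbT enorm_gt0 eqxx.
split=> //.
have [g [g' [dg cg' g0 gP]]] := radial_profile n5 c0 dH d2H W_ge0 E1_ge0.
apply: (integral_ge_of_divergence dg cg') => // x.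
  have [/q_0 ->//|x0] := eqVneq x 0.
  rewrite qE//; apply: mulr_ge0 => //; apply: mulr_ge0; first exact: sqr_ge0.
  by rewrite f0// enorm_gt0.
(* The comparison is pointwise and includes the origin, where [g 0 = 0] and [euler u 0 = 0] make the
   divergence vanish. *)
have [x0|x0] := eqVneq x 0.
  have d0 : dotv x x = 0 by apply/eqP; rewrite dotv_eq0 x0.
  have e0 : euler u x = 0 by apply: big1 => i _; rewrite x0 mxE mul0r.
  rewrite q_0// (divergence_flux smooth_u dg) d0 e0 g0.
  by rewrite expr0n/= !(mul0r, mulr0, addr0, subr0) sqr_ge0.
have t0 : 0 < enorm x by rewrite enorm_gt0.
have [wP eP] := gP _ t0; rewrite !enorm_sqr in wP eP.
apply: le_trans (le_laplacian_sq_sub_div dg x0 _ eP); last by rewrite wP.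
rewrite qE// -(mulrA _ (W _)) -(mulrA _ (E1 _)) -mulrDr -mulrA.
by rewrite ler_wpM2l ?sqr_ge0//; exact: fle.
Qed.

End rellich.

(** * Removal of the regularization *)

Section limit.
Variables (R : realType) (n : nat) (u : 'rV[R]_n -> R) (H : R -> R).
Implicit Types (t s : R) (x : 'rV[R]_n).
Hypothesis n5 : (5 <= n)%N.
Hypothesis smooth_u : smooth u.
Hypothesis csupp_u : compact (closure [set x | u x != 0]).
Hypothesis dH : forall t, 0 < t -> derivable H t 1.
Hypothesis d2H : forall t, 0 < t -> derivable (derive1 H) t 1.

Local Notation W t := (- derive1 H t + H t * ((n%:R - 1) / t) - H t ^+ 2).
Local Notation E1 t := (derive1 H t + H t * ((n%:R - 3) / t)).
Local Notation rho c t := (t ^+ n.-1 / (t ^+ n.-1 + c * H t)).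

Hypothesis W_ge0 : forall t, 0 < t -> 0 <= W t.
Hypothesis E1_ge0 : forall t, 0 < t -> 0 <= E1 t.

Let H_ge0 t : 0 < t -> 0 <= H t.
Proof. by apply: (@riccati_nonneg _ H n) => //; exact: leq_trans n5. Qed.

Lemma rho_antitone (c d t : R) : 0 < t -> 0 < c -> c <= d ->
  rho d t ^+ 2 <= rho c t ^+ 2.
Proof.
move=> t0 c0 cd; have tn : 0 < t ^+ n.-1 by rewrite exprn_gt0.
have d0 : 0 < d by exact: lt_le_trans cd.
have pos b : 0 < b -> 0 < t ^+ n.-1 + b * H t.
  by move=> b0; rewrite ltr_pwDl// mulr_ge0 ?H_ge0// ltW.
have r0 b : 0 < b -> 0 <= rho b t by move=> b0; rewrite divr_ge0 ?ltW// pos.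
rewrite lerXn2r ?nnegrE ?r0// ler_pM2l// lef_pV2 ?posrE ?pos// lerD2l.
by rewrite ler_wpM2r// H_ge0.
Qed.

Lemma cvg_rho t : 0 < t -> rho (k.+1%:R^-1) t ^+ 2 @[k --> \oo] --> (1 : R).
Proof.
move=> t0; have tn : t ^+ n.-1 != 0 by rewrite gt_eqF// exprn_gt0.
have cr : rho (k.+1%:R^-1) t @[k --> \oo] --> (1 : R).
  rewrite -[X in _ --> X](_ : t ^+ n.-1 / (t ^+ n.-1 + 0 * H t) = 1); last first.
    by rewrite mul0r addr0 divff.
  apply: cvgM; first exact: cvg_cst.
  apply: cvgV; first by rewrite mul0r addr0.
  apply: cvgD; first exact: cvg_cst.
  by apply: cvgM; [exact: cvg_harmonic|exact: cvg_cst].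
by rewrite -[X in _ --> X](mulr1 1); exact: cvgM.
Qed.

Lemma laplacian_sq_mkcond (Omega : set 'rV[R]_n) :
  closure [set x | u x != 0] `<=` Omega ->
  (\int[lebesgue_rV R n]_(x in Omega) (`|laplacian u x| ^+ 2)%:E =
   \int[lebesgue_rV R n]_x (laplacian u x ^+ 2)%:E)%E.
Proof.
move=> uOmega; rewrite integral_mkcond; apply: eq_integral => x _.
rewrite patchE; case: ifPn => [_|]; first by rewrite real_normK ?num_real.
rewrite notin_setE => Ox.
have ux : \forall y \near x, u y = 0.
  by apply: near_off_closure => /uOmega.
rewrite /laplacian big1 ?expr0n// => i _.
exact: nbhs_singleton (near_partial0 i (near_partial0 i ux)).
Qed.

(** Monotone convergence along [c = 1 / (k + 1)]. [G] stands for the integrand exactly as it appears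
    in the theorem, which is compared with [f * Q] away from the origin. *)
Lemma rellich_ge (Omega : set 'rV[R]_n) (f : R -> R) (Q G : 'rV[R]_n -> R) :
  closure [set x | u x != 0] `<=` Omega ->
  (forall t, 0 < t -> 0 <= f t) -> (forall t, 0 < t -> {for t, continuous f}) ->
  continuous Q -> (forall x, 0 <= Q x) ->
  (forall x, x != 0 -> f (enorm x) * Q x <=
    W (enorm x) * (euler u x ^+ 2 / dotv x x)
    + E1 (enorm x) * (grad_sq u x - euler u x ^+ 2 / dotv x x)) ->
  (forall x, x != 0 -> G x = f (enorm x) * Q x) ->
  (forall x, ~ Omega x -> G x = 0) ->
  (\int[lebesgue_rV R n]_(x in Omega) (G x)%:E <=
   \int[lebesgue_rV R n]_(x in Omega) (`|laplacian u x| ^+ 2)%:E)%E.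
Proof.
move=> uOmega f0 cf cQ Q0 fle GE GOmega; rewrite laplacian_sq_mkcond//.
pose D := `]0, +oo[%classic : set R.
pose q k x := ((fun t => rho (k.+1%:R^-1) t ^+ 2 * f t) \_ D) (enorm x) * Q x.
have c0 k : 0 < k.+1%:R^-1 :> R by rewrite invr_gt0.
have mqle k := rellich_regularized n5 smooth_u csupp_u dH d2H W_ge0 E1_ge0
  (c0 k) f0 cf cQ Q0 fle.
have Dx x : (enorm x \in D) = (x != 0).
  by rewrite /D mem_setE in_itv/= andbT enorm_gt0.
have qE k x : x != 0 ->
    q k x = rho (k.+1%:R^-1) (enorm x) ^+ 2 * f (enorm x) * Q x.
  by move=> x0; rewrite /q patchE Dx x0.
have q_0 k x : x = 0 -> q k x = 0.
  by move=> x0; rewrite /q patchE Dx x0 eqxx mul0r.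
pose g k x := (q k x)%:E.
have mg k : measurable_fun setT (g k) by apply/measurable_EFinP; exact: (mqle k).1.
have g0 k x : setT x -> (0 <= g k x)%E.
  move=> _; rewrite lee_fin; have [/q_0 ->//|x0] := eqVneq x 0.
  rewrite qE//; apply: mulr_ge0 => //; apply: mulr_ge0; first exact: sqr_ge0.
  by rewrite f0// enorm_gt0.
have ndg x : setT x -> {homo g ^~ x : k l / (k <= l)%N >-> (k <= l)%E}.
  move=> _ k l kl; rewrite lee_fin; have [x0|x0] := eqVneq x 0; first by rewrite !q_0.
  rewrite !qE// ler_wpM2r// ler_wpM2r ?f0 ?enorm_gt0//.
  by apply: rho_antitone; rewrite ?enorm_gt0// lef_pV2 ?posrE// ler_nat.
have cvg_int := cvg_monotone_convergence (mu := lebesgue_rV R n) measurableT mg g0 ndg.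
have GT : (\int[lebesgue_rV R n]_(x in Omega) (G x)%:E =
           \int[lebesgue_rV R n]_x (G x)%:E)%E.
  rewrite integral_mkcond; apply: eq_integral => x _; rewrite patchE.
  by case: ifPn => //; rewrite notin_setE => /GOmega ->.
(* The pointwise limit of the [q k], all of which vanish at the origin; it can differ from [G] only
   on the null set [[set 0]]. *)
pose G0 x := if x == 0 then 0 else G x.
have cvgG0 x : g ^~ x @ \oo --> (G0 x)%:E.
  rewrite /G0; case: eqVneq => x0.
    rewrite (_ : g ^~ x = cst 0%E); first exact: cvg_cst.
    by apply/funext => k; rewrite /g q_0.
  apply: cvg_EFin; first exact: nearW.
  rewrite GE//; rewrite (_ : fine \o _ =
    fun k => rho (k.+1%:R^-1) (enorm x) ^+ 2 * f (enorm x) * Q x); last first.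
    by apply/funext => k; rewrite /= qE.
  rewrite -[f (enorm x) * Q x](mul1r (f _ * _)) mulrA.
  apply: cvgM; last exact: cvg_cst.
  by apply: cvgM; [apply: cvg_rho; rewrite enorm_gt0|exact: cvg_cst].
have mG0 : measurable_fun setT (fun x => (G0 x)%:E).
  exact: emeasurable_fun_cvg mg (fun x _ => cvgG0 x).
have mG : measurable_fun setT (fun x => (G x)%:E).
  rewrite (_ : (fun x => _) = (fun x => if x == 0 then (G 0)%:E else (G0 x)%:E)).
    apply: measurable_fun_ifT => //; apply: (measurable_fun_bool true).
    rewrite setTI (_ : _ @^-1` _ = [set 0]); first exact: measurable_set1_rV.
    by apply/seteqP; split=> x /= /eqP.
  by apply/funext => x; rewrite /G0; case: eqVneq => [->|].
have -> : (\int[lebesgue_rV R n]_(x in Omega) (G x)%:E =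
    \int[lebesgue_rV R n]_x limn (g ^~ x))%E.
  rewrite GT; under [RHS]eq_integral do rewrite (cvg_lim _ (cvgG0 _))//.
  apply: ae_eq_integral => //; exists [set 0]; split.
  - exact: measurable_set1_rV.
  - by apply: lebesgue_rV_set1; exact: leq_trans n5.
  - move=> x /= xG; apply: contrapT => /eqP x0; apply: xG => _.
    by rewrite /G0 (negbTE x0).
rewrite -(cvg_lim _ cvg_int)//; apply: lime_le.
  by apply/cvg_ex; eexists; exact: cvg_int.
by apply: nearW => k; exact: (mqle k).2.
Qed.

End limit.

(** * The inequalities for the radial derivative and for the full gradient *)

Theorem theorem1p1 (R : realType) (n : nat) (hn : (5 <= n)%N)
    (Omega : set 'rV[R]_n) (hOmega : open Omega)
    (V H : R -> R)
    (hV0 : forall t : R, 0 < t -> 0 <= V t)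
    (hV : smooth_pos V) (hH : smooth_pos H)
    (hVH : forall t : R, 0 < t ->
      - derive1 H t + H t * ((n%:R - 1) / t) - H t ^+ 2 >= V t) :
  ((forall t : R, 0 < t -> derive1 H t + H t * ((n%:R - 3) / t) >= 0) ->
   forall u : 'rV[R]_n -> R, test_function Omega u ->
     (\int[lebesgue_rV R n]_(x in Omega) (`|laplacian u x| ^+ 2)%:E >=
      \int[lebesgue_rV R n]_(x in Omega)
        (V (enorm x) * `|rad_deriv u x| ^+ 2)%:E)%E)
  /\
  ((forall t : R, 0 < t -> 2 * derive1 H t + H t * (H t - 2 / t) >= 0) ->
   forall u : 'rV[R]_n -> R, test_function Omega u ->
     (\int[lebesgue_rV R n]_(x in Omega) (`|laplacian u x| ^+ 2)%:E >=
      \int[lebesgue_rV R n]_(x in Omega)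
        (V (enorm x) * enorm (grad u x) ^+ 2)%:E)%E).
Proof.
have dH t : 0 < t -> derivable H t 1 by exact: hH 0%N t.
have d2H t : 0 < t -> derivable (derive1 H) t 1 by exact: hH 1%N t.
have W_ge0 t : 0 < t ->
    0 <= - derive1 H t + H t * ((n%:R - 1) / t) - H t ^+ 2.
  by move=> t0; exact: le_trans (hV0 t t0) (hVH t t0).
have cV t : 0 < t -> {for t, continuous V}.
  by move=> t0; apply: differentiable_continuous; apply/derivable1_diffP/(hV 0%N).
have sq0 (x : 'rV[R]_n) (u : 'rV[R]_n -> R) : 0 <= euler u x ^+ 2 / dotv x x.
  by rewrite divr_ge0 ?sqr_ge0 ?dotv_ge0.
have grad0 (u : 'rV[R]_n -> R) x : closure [set y | u y != 0] `<=` Omega ->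
    ~ Omega x -> grad u x = 0.
  move=> uOmega Ox; have ux : \forall y \near x, u y = 0.
    by apply: near_off_closure => /uOmega.
  by apply/rowP => i; rewrite !mxE; exact: nbhs_singleton (near_partial0 i ux).
split=> [E1_ge0|E2_ge0] u [smooth_u csupp_u uOmega].
  (* The squared radial derivative is [euler^2 / |x|^2]; moving [1 / t^2] into the weight [f] leaves
     a factor [Q] that is continuous at the origin. *)
  apply: (rellich_ge hn smooth_u csupp_u dH d2H W_ge0 E1_ge0 uOmega
    (f := fun t => V t / t ^+ 2) (Q := fun x => euler u x ^+ 2)).
  - by move=> t t0; rewrite divr_ge0 ?sqr_ge0 ?hV0.
  - move=> t t0; apply: cvgM; first exact: cV.
    by apply: cvgV; [rewrite expf_neq0// gt_eqF|exact: exprn_continuous].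
  - move=> x; apply: (continuous_comp (g := fun r : R => r ^+ 2)).
      exact: continuous_euler.
    exact: exprn_continuous.
  - by move=> x; exact: sqr_ge0.
  - move=> x x0; have t0 : 0 < enorm x by rewrite enorm_gt0.
    rewrite -[leLHS]addr0 lerD//.
      by rewrite -mulrA [_^-1 * _]mulrC enorm_sqr ler_wpM2r// hVH.
    by rewrite mulr_ge0 ?E1_ge0// subr_ge0 euler_sq_le.
  - move=> x x0; rewrite real_normK ?num_real// rad_derivE.
    by rewrite exprMn exprVn mulrA.
  - move=> x /(grad0 _ _ uOmega) ux.
    have x0 : dotv x 0 = 0 :> R by apply: big1 => i _; rewrite mxE mulr0.
    by rewrite rad_derivE -dotv_grad ux x0 mulr0 normr0 expr0n mulr0.
have WE1 t : 0 < t -> - derive1 H t + H t * ((n%:R - 1) / t) - H t ^+ 2 <=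
    derive1 H t + H t * ((n%:R - 3) / t).
  move=> t0; rewrite -subr_ge0; have := E2_ge0 t t0; congr (0 <= _).
  by field; rewrite gt_eqF.
have E1_ge0 t : 0 < t -> 0 <= derive1 H t + H t * ((n%:R - 3) / t).
  by move=> t0; exact: le_trans (W_ge0 t t0) (WE1 t t0).
apply: (rellich_ge hn smooth_u csupp_u dH d2H W_ge0 E1_ge0 uOmega
  (f := V) (Q := grad_sq u)) => //.
- exact: continuous_grad_sq.
- by move=> x; rewrite -enorm_grad_sqr sqr_ge0.
- move=> x x0; have t0 : 0 < enorm x by rewrite enorm_gt0.
  (* Splits [grad_sq] into its radial and tangential parts, to be compared separately. *)
  rewrite -[X in V _ * X](subrKC (euler u x ^+ 2 / dotv x x)) mulrDr lerD//.
    by rewrite ler_wpM2r// hVH.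
  rewrite ler_wpM2r ?subr_ge0 ?euler_sq_le//.
  exact: le_trans (hVH _ t0) (WE1 _ t0).
- by move=> x _; rewrite enorm_grad_sqr.
- move=> x /(grad0 _ _ uOmega) ux.
  by rewrite ux enorm_sqr [dotv _ _]big1 ?mulr0// => i _; rewrite mxE mul0r.
Qed.
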